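(* Let $\ell\geq 3$ be a prime, $q$ a prime power coprime to $\ell$, $f(x)\in\mathbf{F}_q[x]$ irreducible of degree $d$ coprime to $\ell$, and $C/\mathbf{F}_q$ the smooth projective curve with affine equation $y^\ell=f(x)$, with Jacobian $J$. Then $r_\ell(C):=\dim_{\mathbf{F}_\ell}J[\ell](\mathbf{F}_q)$ equals the number of integers $1\leq k\leq \ell-1$ such that the set $F_{k-1}^k\subseteq J[\ell]$ (defined in the context) contains an eigenvector of $\mathrm{Frob}$.
   Context: Write $J[\ell]:=J[\ell](\overline{\mathbf{F}}_q)$, an $\mathbf{F}_\ell$-vector space. Let $\gamma$ be the multiplicative order of $q$ in $(\mathbf{Z}/\ell\mathbf{Z})^\times$ and fix a nontrivial $\ell$-th root of unity $\zeta\in\mathbf{F}_{q^\gamma}$. The map $(x,y)\mapsto(x,\zeta y)$ on $C(\overline{\mathbf{F}}_q)$ induces (by its action on divisor classes) an automorphism of $J_{\overline{\mathbf{F}}_q}$, and hence a linear map on $J[\ell]$, also denoted $\zeta$. The map $(x,y)\mapsto(x^q,y^q)$ induces in the same way an endomorphism of $J_{\overline{\mathbf{F}}_q}$ and a linear map on $J[\ell]$, denoted $\mathrm{Frob}$. For $0\le k\le\ell-1$ let $V^k$ be the kernel of $(1-\zeta)^k$ on $J(\overline{\mathbf{F}}_q)$; then $0=V^0\subseteq V^1\subseteq\cdots\subseteq V^{\ell-1}=J[\ell]$. For $1\le k\le \ell-1$ and $n\in\mathbf{Z}/\gamma\mathbf{Z}$, $F_n^k$ is the set of $v\in V^k\setminus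 V^{k-1}$ with $(\mathrm{Frob}-q^{n-k+1})^iv=0$ for some $i\ge1$ (the scalar $q^{n-k+1}\in\mathbf{F}_\ell$ is well defined since $q^\gamma=1$ in $\mathbf{F}_\ell$). In $F_{k-1}^k$ the lower index is taken modulo $\gamma$. Eigenvectors of $\mathrm{Frob}$ are nonzero $v\in J[\ell]$ with $\mathrm{Frob}\,v=cv$ for some $c\in\mathbf{F}_\ell$. *)

(* Defs.v *)
From HB Require Import structures.
From mathcomp Require Import all_boot all_order all_algebra.
From mathcomp Require Import boolp classical_sets.
From mathcomp Require Import freeg.

Set Implicit Arguments.
Unset Strict Implicit.
Unset Printing Implicit Defensive.

Import Order.TTheory GRing.Theory Num.Theory.

Local Open Scope ring_scope.
Local Open Scope quotient_scope.

(* L is the function field K(C) of the curve C : y^l = h(x) over K, for K     *)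
(* algebraically closed and deg h prime to l (so that Y^l - h is irreducible  *)
(* over K(x), and L is determined up to a unique isomorphism).                *)
Definition function_field (K L : fieldType) (j : {rmorphism K -> L})
    (l : nat) (h : {poly K}) (x y : L) : Prop :=
  [/\ ~ algebraicOver j x,
      y ^+ l = (map_poly j h).[x]
    & forall g : L, exists P Q : {poly {poly K}},
        (map_poly (map_poly j) Q).[x, y] != 0 /\
        g = (map_poly (map_poly j) P).[x, y]
              / (map_poly (map_poly j) Q).[x, y]].

(* The comorphism of the self-map (x, y) |-> (x', y') of C over K.            *)
Definition comorphism (K L : fieldType) (j : {rmorphism K -> L}) (x y : L)
    (theta : L -> L) (x' y' : L) : Prop :=
  [/\ forall a : K, theta (j a) = j a, theta x = x' & theta y = y'].

(* For K algebraically closed, the K-points of the smooth projective curve    *)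
(* with function field L are the places of L / K, i.e. the normalized         *)
(* discrete valuations of L that are trivial on K.                            *)
Section Jacobian.

Variables (K L : fieldType) (j : {rmorphism K -> L}).

(* The junk value v 0 = 0 stands for +oo; fixing it makes equality of places  *)
(* the equality of the underlying functions.                                  *)
Definition is_place (v : L -> int) : Prop :=
  [/\ v 0 = 0,
      forall a : K, a != 0 -> v (j a) = 0,
      forall g h, g != 0 -> h != 0 -> v (g * h) = v g + v h,
      forall g h, g != 0 -> h != 0 -> g + h != 0 ->
        Num.min (v g) (v h) <= v (g + h)
    & exists2 t, t != 0 & v t = 1].

Definition place : Type := {v : L -> int | `[< is_place v >]}.
HB.instance Definition _ := SubChoice.on place.

Definition ord (P : place) (g : L) : int := val P g.

(* The image of P under the self-map of the curve with comorphism theta: the  *)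
(* place whose valuation ring is the inverse image of that of P.              *)
Definition place_image (theta : L -> L) (P : place) : place :=
  xget P [set Q : place |
    forall g, (0 <= ord Q g) = (0 <= ord P (theta g))]%classic.

Notation divisor := {freeg place / int}.

Definition push_div (theta : L -> L) (D : divisor) : divisor :=
  \sum_(P <- dom D) << coeff P D *g place_image theta P >>.

Lemma deg_push_div theta D : deg (push_div theta D) = deg D.
Proof.
rewrite -[D in RHS]freeg_sumE !raddf_sum /=.
by apply: eq_bigr => P _; rewrite !degU.
Qed.

Definition degree0 : {pred divisor} := [pred D : divisor | deg D == 0].

Fact degree0_zmod_closed : zmod_closed degree0.
Proof.
split; first by rewrite inE deg0.
by move=> D E; rewrite !inE degB => /eqP-> /eqP->; rewrite subrr.
Qed.
HB.instance Definition _ :=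
  GRing.isZmodClosed.Build divisor degree0 degree0_zmod_closed.

Definition div0 : Type := {D : divisor | D \in degree0}.
HB.instance Definition _ := SubChoice.on div0.
HB.instance Definition _ := [SubChoice_isSubZmodule of div0 by <:].

Definition is_principal (D : div0) : Prop :=
  exists2 g : L, g != 0 & forall P : place, coeff P (val D) = ord P g.

Definition principal : {pred div0} := [pred D : div0 | `[< is_principal D >]].

Lemma principalP (D : div0) : reflect (is_principal D) (D \in principal).
Proof. by rewrite inE; apply: asboolP. Qed.

Lemma ord1 (P : place) : ord P 1 = 0.
Proof.
case/asboolP: (valP P) => _ vK _ _ _.
by rewrite -(rmorph1 j) [LHS]vK ?oner_eq0.
Qed.

Lemma ordM (P : place) g h :
  g != 0 -> h != 0 -> ord P (g * h) = ord P g + ord P h.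
Proof. by case/asboolP: (valP P) => _ _ vM _ _; apply: vM. Qed.

Fact principal_zmod_closed : zmod_closed principal.
Proof.
split.
  apply/principalP; exists 1; first exact: oner_neq0.
  by move=> P; rewrite ord1; apply: coeff0.
move=> D E /principalP[g g0 Dg] /principalP[h h0 Eh].
apply/principalP; exists (g / h); first by rewrite mulf_neq0 ?invr_eq0.
move=> P; rewrite [coeff P _](coeffB P (val D) (val E)) Dg Eh.
apply/eqP; rewrite subr_eq -ordM ?mulf_neq0 ?invr_eq0 //.
by rewrite divfK.
Qed.
HB.instance Definition _ :=
  GRing.isZmodClosed.Build div0 principal principal_zmod_closed.

Definition jacobian : Type := Quotient.quot principal.
HB.instance Definition _ := GRing.Zmodule.on jacobian.
HB.instance Definition _ := ZmodQuotient.on jacobian.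

Definition push_div0 (theta : L -> L) (D : div0) : div0 :=
  insubd (0 : div0) (push_div theta (val D)).

(* The effect on divisor classes of the self-map of the curve with comorphism *)
(* theta. A direct image of a principal divisor is principal (it is the       *)
(* divisor of a norm), so the choice of representative is immaterial.         *)
Definition push (theta : L -> L) (c : jacobian) : jacobian :=
  \pi_jacobian (push_div0 theta (repr c)).

End Jacobian.

(* In an abelian group A, the subgroup A[l] is an 'F_l-vector space for this  *)
(* scaling, which is meaningful on A[l] only.                                 *)
Definition Fl_scale (A : zmodType) (l : nat) (c : 'F_l) (v : A) : A := v *+ c.

Definition torsion (A : zmodType) (l : nat) (v : A) : Prop := v *+ l = 0.

(* The subspace S of A[l] has a basis with r elements over 'F_l.              *)
Definition is_dim_Fl (A : zmodType) (l : nat) (S : A -> Prop) (r : nat) :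
    Prop :=
  exists e : 'I_r -> A,
    (forall i, S (e i)) /\
    forall v, S v ->
      exists! c : {ffun 'I_r -> 'F_l}, v = \sum_(i < r) Fl_scale (c i) (e i).

Section Filtration.

Variables (A : zmodType) (l q : nat) (Frob zeta : A -> A).

(* The kernel of (1 - zeta)^k.                                                *)
Definition V_ (k : nat) (v : A) : Prop :=
  iter k (fun w => w - zeta w) v = 0.

(* The set F_n^k, for 1 <= k <= l - 1. As q^gamma = 1 in 'F_l, for gamma the  *)
(* order of q, it depends only on n modulo gamma: n is any integer lift.      *)
Definition F_ (n : int) (k : nat) (v : A) : Prop :=
  let c : 'F_l := q%:R ^ (n - k%:Z + 1) in
  [/\ V_ k v, ~ V_ k.-1 v
    & exists2 i : nat, (0 < i)%N &
        iter i (fun w => Frob w - Fl_scale c w) v = 0].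

Definition eigenvector (v : A) : Prop :=
  [/\ torsion l v, v != 0 & exists c : 'F_l, Frob v = Fl_scale c v].

End Filtration.

(* J(F): the classes of J(K) invariant under Gal(K / F), identified with the  *)
(* group of automorphisms of K(C) over F(C) = F(x, y); such an automorphism   *)
(* maps the constant field K onto itself.                                     *)
Definition rational (F K L : fieldType) (iota : {rmorphism F -> K})
    (j : {rmorphism K -> L}) (x y : L) (c : jacobian j) : Prop :=
  forall tau : {rmorphism L -> L},
    bijective tau -> (forall a : F, tau (j (iota a)) = j (iota a)) ->
    tau x = x -> tau y = y -> push tau c = c.

(* Main.v *)
(* Write D = 1 - zeta on J. On J[l] one has D^(l-1) = 0, since (1 - X)^(l-1)   *)
(* and 1 + X + ... + X^(l-1) coincide over F_l and the orbit sums of zeta are  *)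
(* principal up to multiples of infinity. As q^0 = 1, an index k is counted    *)
(* when some v fixed by Frob lies in V^k but not in V^(k-1), so the claim is   *)
(* that the Frob-fixed part of each V^k / V^(k-1) has dimension at most 1.     *)
(* Since Frob zeta = zeta^q Frob, the map D^(k-1) carries Frob-fixed vectors   *)
(* of V^k to the eigenspace of Frob on V^1 for q^(k-1). By Hilbert 90, V^1 is  *)
(* generated by the classes of (a, 0) - infinity for the roots a of f; f being *)
(* irreducible, Frob permutes them cyclically, so V^1 is a cyclic              *)
(* F_l[Frob]-module and its eigenspaces are at most lines.                     *)
(*                                                                             *)
(* The places of L are determined by hand: over a smooth point (a, b) of the   *)
(* curve the local ring is a discrete valuation ring because every element of  *)
(* K[x, y] divides a non-zero polynomial in x, its norm; the place at infinity *)
(* is a ramified point of another curve t^l = z u(z) with the same function    *)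
(* field. Finally frobL is the q-th power map composed with the inverse of an  *)
(* automorphism, through which Frob acts, and any automorphism of L over       *)
(* F(x, y) agrees with an iterate of Frob on finitely many places, so          *)
(* rationality means being fixed by Frob.                                      *)

Require Import Defs.
From HB Require Import structures.
From mathcomp Require Import all_boot all_order all_algebra.
From mathcomp Require Import pgroup abelian cyclic separable finfield
  cyclotomic.
From mathcomp Require Import boolp classical_sets freeg.
From mathcomp Require Import ring zify.

Set Implicit Arguments.
Unset Strict Implicit.
Unset Printing Implicit Defensive.

Import Order.TTheory GRing.Theory Num.Theory.
Local Open Scope ring_scope.
Local Open Scope quotient_scope.

(** * Linear algebra *)

(** The Frob-fixed torsion classes are filtered by the kernels of the powers of D = 1 - zeta, and
    D^(k-1) embeds the k-th graded piece into the q^(k-1)-eigenspace of Frob on ker D. That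
    eigenspace is at most a line, so the dimension is the number of nonzero graded pieces; the k-th
    one is nonzero exactly when the set in the statement has an eigenvector, whose eigenvalue is
    then q^0 = 1. [Frobenius_fixed_dim] carries this out for an abstract group with two additive
    maps, using [cyclic_eigenspace] and [filtration_basis].

    The curve supplies three facts: the commutation rule Frob zeta = zeta^q Frob ([push_s_zeta]),
    the vanishing of orbit sums ([sum_push]), and the generation of ker D by the branch points
    ([ker_push]). For the last, an invariant class gives a function of constant norm; [hilbert90]
    then moves the divisor to an invariant one, which is a combination of branch points and of
    fibres of x. By [irreducible_frob_orbit] the branch points form one Frobenius orbit, so ker D is
    cyclic. [push_fixed_rational] translates rationality into being fixed by Frob. *)

Section PolyAction.

Variables (k : fieldType) (V : lmodType k) (F : {linear V -> V}).
Implicit Types (p q : {poly k}) (v w : V).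

Definition poly_act p v := \sum_(i < size p) p`_i *: iter i F v.

Lemma iter_linearP n a v w :
  iter n F (a *: v + w) = a *: iter n F v + iter n F w.
Proof. by elim: n => //= n ->; rewrite linearP. Qed.

Lemma poly_act_wide n p v : (size p <= n)%N ->
  poly_act p v = \sum_(i < n) p`_i *: iter i F v.
Proof.
move=> le_pn; rewrite /poly_act (big_ord_widen n (fun i =>
  p`_i *: iter i F v)) //.
rewrite big_mkcond; apply: eq_bigr => i _; case: ltnP => // le_pi.
by rewrite nth_default ?scale0r.
Qed.

Lemma poly_actD p q v : poly_act (p + q) v = poly_act p v + poly_act q v.
Proof.
pose n := maxn (size p) (size q).
rewrite (@poly_act_wide n) ?size_polyD // (@poly_act_wide n p) ?leq_maxl //.
rewrite (@poly_act_wide n q) ?leq_maxr // -big_split.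
by apply: eq_bigr => i _; rewrite coefD scalerDl.
Qed.

Lemma poly_actZ c p v : poly_act (c *: p) v = c *: poly_act p v.
Proof.
rewrite (@poly_act_wide (size p)) ?size_scale_leq // scaler_sumr.
by apply: eq_bigr => i _; rewrite coefZ scalerA.
Qed.

Lemma poly_act_linear p a v w :
  poly_act p (a *: v + w) = a *: poly_act p v + poly_act p w.
Proof.
rewrite scaler_sumr -big_split; apply: eq_bigr => i _.
by rewrite iter_linearP scalerDr !scalerA mulrC.
Qed.

HB.instance Definition _ p :=
  GRing.isLinear.Build k V V *:%R (poly_act p) (poly_act_linear p).

Lemma poly_actC c v : poly_act c%:P v = c *: v.
Proof.
rewrite (@poly_act_wide 1) ?size_polyC_leq1 //.
by rewrite big_ord1 coefC.
Qed.

Lemma poly_act_mulX p v : poly_act (p * 'X) v = poly_act p (F v).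
Proof.
rewrite (@poly_act_wide (size p).+1); last first.
  by apply: leq_trans (size_polyMleq _ _) _; rewrite size_polyX addn2.
rewrite big_ord_recl coefMX scale0r add0r; apply: eq_bigr => i _.
by rewrite coefMX /= -iterS iterSr.
Qed.

Lemma poly_actXn n v : poly_act 'X^n v = iter n F v.
Proof.
elim: n v => [|n IH] v; first by rewrite (poly_actC 1) scale1r.
by rewrite exprSr poly_act_mulX IH -iterSr.
Qed.

Lemma poly_act_comm p v : poly_act p (F v) = F (poly_act p v).
Proof.
rewrite linear_sum; apply: eq_bigr => i _.
by rewrite linearZ /= -iterSr.
Qed.

Lemma poly_actM p q v : poly_act (p * q) v = poly_act p (poly_act q v).
Proof.
elim/poly_ind: p v => [|p c IH] v.
  by rewrite mul0r /poly_act size_poly0 !big_ord0.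
rewrite mulrDl mulrAC !poly_actD !poly_act_mulX.
rewrite IH poly_act_comm.
by rewrite mul_polyC poly_actZ poly_actC.
Qed.

Lemma poly_act_eigen p c v : F v = c *: v -> poly_act p v = p.[c] *: v.
Proof.
move=> Fv; elim/poly_ind: p => [|p a IH].
  by rewrite /poly_act size_poly0 big_ord0 horner0 scale0r.
rewrite poly_actD poly_act_mulX Fv linearZ /= IH poly_actC hornerMXaddC.
by rewrite scalerA -scalerDl mulrC.
Qed.

Lemma poly_act_XsubC c v : poly_act ('X - c%:P) v = F v - c *: v.
Proof.
rewrite poly_actD -[- _]scaleN1r poly_actZ poly_actC scaleN1r.
by rewrite -[in poly_act 'X _](mul1r 'X) poly_act_mulX (poly_actC 1) scale1r.
Qed.

(* The eigenspace in the cyclic module k[X] / (m) is generated by             *)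
(* m / ('X - c).                                                              *)
Lemma cyclic_eigenspace w p0 c : p0 != 0 -> poly_act p0 w = 0 ->
  exists v0, forall p, F (poly_act p w) = c *: poly_act p w ->
    exists s, poly_act p w = s *: v0.
Proof.
move=> p0_neq0 p0w.
(* [m] will be a nonzero annihilator of [w] of least size; by division with remainder it divides
   every annihilator. *)
have ex_size : exists n, `[< exists m :
  {poly k}, [/\ m != 0, size m = n & poly_act m w = 0] >].
  by exists (size p0); apply/asboolP; exists p0.
have [_ /asboolP[m [m0 <- mw]] m_min] := ex_minnP ex_size.
have dvd_ann p : poly_act p w = 0 -> m %| p.
  move=> pw; rewrite /dvdp; apply/negPn/negP => r0.
  have /m_min : `[< exists r :
    {poly k}, [/\ r != 0, size r = size (p %% m) & poly_act r w = 0] >].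
    apply/asboolP; exists (p %% m); split=> //.
    by move: pw; rewrite {1}(divp_eq p m) poly_actD poly_actM mw linear0 add0r.
  by rewrite leqNgt ltn_modp m0.
have eigen_dvd p : F (poly_act p w) = c *: poly_act p w -> m %| ('X - c%:P) * p.
  by move=> Fp; apply: dvd_ann; rewrite poly_actM poly_act_XsubC Fp subrr.
(* If [c] is not a root of [m], then [m] is prime to X - c and every eigenvector in the cyclic
   module is zero, so 0 serves as generator. *)
have [/factor_theorem[m1 m_eq] | not_root] := boolP (root m c); last first.
  exists 0 => p /eigen_dvd; rewrite Gauss_dvdpr; last first.
    by rewrite coprimep_XsubC.
  by case/dvdpP=> r ->; exists 0; rewrite poly_actM mw linear0 scaler0.
have Fv0 : F (poly_act m1 w) = c *: poly_act m1 w.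
  by apply/eqP; rewrite -subr_eq0 -poly_act_XsubC -poly_actM mulrC -m_eq mw.
exists (poly_act m1 w) => p /eigen_dvd.
rewrite m_eq [_ * p]mulrC dvdp_mul2r ?polyXsubC_eq0 // => /dvdpP[r ->].
by exists r.[c]; rewrite poly_actM (poly_act_eigen _ Fv0).
Qed.

End PolyAction.

(* D^k is written [iter k D]; the family e is triangular for the filtration   *)
(* by the kernels of the D^k.                                                 *)
Lemma filtration_basis (k : fieldType) (V : lmodType k) (D : {linear V -> V})
    (W : V -> Prop) (l : nat) (S : {set 'I_l}) (e : 'I_l -> V) :
    (forall a v w, W v -> W w -> W (a *: v + w)) ->
    (forall v, W v -> iter l.-1 D v = 0) ->
    (forall i, i \in S -> [/\ (0 < i)%N, W (e i), iter i D (e i) = 0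
                            & iter i.-1 D (e i) != 0]) ->
    (forall (i : 'I_l) v, (0 < i)%N -> W v -> iter i D v = 0 ->
       if i \in S then exists a, iter i.-1 D (v - a *: e i) = 0
       else iter i.-1 D v = 0) ->
  forall v, W v -> exists! c : {ffun 'I_#|S| -> k},
    v = \sum_(i < #|S|) c i *: e (enum_val i).
Proof.
move=> W_lin W_nil eP step.
(* Induction along the filtration: a vector of level n + 1 drops to level n, if need be after
   subtracting a multiple of the [e] of that index. *)
have span n v : (n < l)%N -> W v -> iter n D v = 0 ->
    exists c : 'I_l -> k, v = \sum_(i in S) c i *: e i.
  elim: n v => [|n IH] v lt_n Wv /= Dv.
    by exists (fun=> 0); rewrite Dv big1 // => i _; rewrite scale0r.
  have := step (Ordinal lt_n) v isT Wv Dv.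
  case: ifP => inS /= [].
    move=> a Da.
    have [|c v_eq] := IH (v - a *: e (Ordinal lt_n)) (ltnW lt_n) _ Da.
      rewrite addrC -scaleNr; apply: W_lin => //.
      by have [] := eP _ inS.
    exists (fun i => c i + (i == Ordinal lt_n)%:R * a).
    rewrite -[LHS](subrK (a *: e (Ordinal lt_n))) v_eq.
    under [RHS]eq_bigr do rewrite scalerDl.
    rewrite big_split /=; congr (_ + _).
    rewrite (bigD1 (Ordinal lt_n)) //= eqxx mul1r big1 ?addr0 // =>
      i /andP[_ /negPf->].
    by rewrite mul0r scale0r.
  by move=> Dn; apply: (IH v (ltnW lt_n) Wv).
(* If m is the largest index with a nonzero coefficient, D^(m-1) kills every term of the sum except
   the one at m. *)
have free (c : 'I_l -> k) : \sum_(i in S) c i *: e i = 0 ->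
    forall i, i \in S -> c i = 0.
  move=> sum0 i iS; apply/eqP/negPn/negP => ci0.
  pose P := [pred i | (i \in S) && (c i != 0)].
  have Pi : P i by rewrite /= iS.
  case: (@arg_maxnP _ i P (fun i : 'I_l => i : nat) Pi) => m /andP[mS cm] m_max.
  have [m_gt0 _ Dm Dm1] := eP m mS.
  have : iter m.-1 D (\sum_(i in S) c i *: e i) = c m *: iter m.-1 D (e m).
    have iter_sum n I (r : seq I) Q (f : I -> V) :
        iter n D (\sum_(i <- r | Q i) f i) = \sum_(i <- r | Q i) iter n D (f i).
      by elim: n => //= n ->; rewrite linear_sum.
    have iterZ n a v : iter n D (a *: v) = a *: iter n D v.
      by elim: n => //= n ->; rewrite linearZ.
    have iter0 n : iter n D 0 = 0 by elim: n => //= n ->; rewrite linear0.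
    rewrite iter_sum (bigD1 m) //= iterZ big1 ?addr0 // => h /andP[hS neq_hm].
    rewrite iterZ; have [-> | ch0] := eqVneq (c h) 0; first by rewrite scale0r.
    have le_hm : (h <= m)%N by apply: m_max; rewrite /= hS.
    have lt_hm : (h <= m.-1)%N.
      by rewrite -ltnS prednK // ltn_neqAle le_hm andbT;
        apply: contra neq_hm => /eqP/val_inj->.
    have [_ _ Dh _] := eP h hS.
    by rewrite -(subnK lt_hm) iterD Dh iter0 scaler0.
  rewrite sum0; have -> : iter m.-1 D 0 = 0 by elim: m.-1 => //= n ->;
    rewrite linear0.
  by move/esym/eqP; rewrite scaler_eq0 (negPf cm) (negPf Dm1).
have reindexS (c : 'I_l -> k) :
    \sum_(i in S) c i *: e i = \sum_(i < #|S|) c (enum_val i) *: e (enum_val i).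
  exact: big_enum_val.
move=> v Wv.
have [c v_eq] : exists c : 'I_l -> k, v = \sum_(i in S) c i *: e i.
  case: l => [|l'] in S e W_nil eP step span free reindexS *.
    by exists (fun=> 0); rewrite big1 => [|[]//]; apply: (W_nil v Wv).
  exact: (span l' v _ Wv (W_nil v Wv)).
exists [ffun i => c (enum_val i)]; split.
  by rewrite v_eq reindexS; apply: eq_bigr => i _; rewrite ffunE.
move=> c' v_eq'; apply/ffunP => i; rewrite ffunE.
(* [c2] extends [c'] to all indices; its values outside [S] do not enter the sums. *)
pose c2 h := c' (enum_rank_in (enum_valP i) h).
have c2E (n : 'I_#|S|) : c2 (enum_val n) = c' n.
  by rewrite /c2 enum_valK_in.
apply/eqP; rewrite -subr_eq0 -c2E; apply/eqP.
apply: (free (fun h => c h - c2 h)); last exact: enum_valP.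
under eq_bigr do rewrite scalerBl.
rewrite sumrB -v_eq (reindexS c2) v_eq'; apply/eqP; rewrite subr_eq0; apply/eqP.
by apply: eq_bigr => n _; rewrite c2E.
Qed.

Lemma mulrn_modn (A : zmodType) (m n : nat) (v : A) :
  v *+ m = 0 -> v *+ (n %% m) = v *+ n.
Proof.
by move=> vm; rewrite {2}(divn_eq n m) mulrnDr mulnC mulrnA vm mul0rn add0r.
Qed.

(** * The torsion subgroup as a vector space over the prime field *)

Section TorsionModule.

Variables (A : zmodType) (l : nat).

(* For l prime this is l, see [Fp_cast]; using the size of 'F_l itself makes  *)
(* the subgroup an 'F_l-module for any l.                                     *)
Local Notation p := (Zp_trunc (pdiv l)).+2.

Definition Fl_torsion : {pred A} := [pred v | v *+ p == 0].

Fact Fl_torsion_zmod_closed : zmod_closed Fl_torsion.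
Proof.
split=> [|u v]; rewrite !inE ?mul0rn // => /eqP u0 /eqP v0.
by rewrite mulrnBl u0 v0 subrr.
Qed.
HB.instance Definition _ :=
  GRing.isZmodClosed.Build A Fl_torsion Fl_torsion_zmod_closed.

Definition tors : Type := {v : A | v \in Fl_torsion}.
HB.instance Definition _ := SubChoice.on tors.
HB.instance Definition _ := [SubChoice_isSubZmodule of tors by <:].

Definition telt (v : tors) : A := val v.

Arguments telt : simpl never.

Lemma telt_inj : injective telt.
Proof. exact: val_inj. Qed.

Fact telt_is_zmod_morphism : zmod_morphism telt.
Proof. exact: (raddfB (val : tors -> A)). Qed.
HB.instance Definition _ :=
  GRing.isZmodMorphism.Build tors A telt telt_is_zmod_morphism.

Lemma telt_tors (v : tors) : telt v *+ p = 0.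
Proof. exact/eqP/(valP v). Qed.

Lemma torsMp (v : tors) : v *+ p = 0.
Proof. by apply: telt_inj; rewrite raddfMn telt_tors raddf0. Qed.

Definition tors_scale (c : 'F_l) (v : tors) : tors := v *+ c.

Fact tors_scaleA c d v : tors_scale c (tors_scale d v) = tors_scale (c * d) v.
Proof. by rewrite /tors_scale -mulrnA mulnC mulrn_modn ?torsMp. Qed.
Fact tors_scale1 : left_id 1 tors_scale.
Proof. by move=> v; rewrite /tors_scale mulrn_modn ?torsMp. Qed.
Fact tors_scaleDr : right_distributive tors_scale +%R.
Proof. by move=> c u v; rewrite /tors_scale mulrnDl. Qed.
Fact tors_scaleDl v : {morph tors_scale^~ v : c d / c + d}.
Proof. by move=> c d; rewrite /tors_scale mulrn_modn ?torsMp // mulrnDr. Qed.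
HB.instance Definition _ := GRing.Zmodule_isLmodule.Build 'F_l tors
  tors_scaleA tors_scale1 tors_scaleDr tors_scaleDl.

Lemma teltZ (c : 'F_l) (v : tors) : telt (c *: v) = Fl_scale c (telt v).
Proof. exact: raddfMn. Qed.

Variable f : {additive A -> A}.

Fact tors_map_subproof (v : tors) : f (telt v) \in Fl_torsion.
Proof. by rewrite inE -raddfMn telt_tors raddf0. Qed.

Definition tors_map (v : tors) : tors := Sub (f (telt v)) (tors_map_subproof v).

Lemma telt_map v : telt (tors_map v) = f (telt v).
Proof. exact: SubK. Qed.

Fact tors_map_linear : linear tors_map.
Proof.
move=> c u v; apply: telt_inj.
by rewrite telt_map (raddfD (@telt)) /= (raddfD f) (raddfD (@telt)) /= !teltZ
  !telt_map /Fl_scale raddfMn.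
Qed.
HB.instance Definition _ :=
  GRing.isLinear.Build 'F_l tors tors *:%R tors_map tors_map_linear.

Lemma telt_iter_map n v : telt (iter n tors_map v) = iter n f (telt v).
Proof. by elim: n => //= n IH; rewrite telt_map IH. Qed.

End TorsionModule.

(** Multiplied by 1 - X, both sides become 1 - X^l, since the l-th power map is additive in
    characteristic l. *)
Lemma exprB1_Fl (l : nat) : prime l ->
  (1 - 'X : {poly 'F_l}) ^+ l.-1 = \sum_(i < l) 'X^i.
Proof.
move=> l_pr; have X1_neq0 : (1 - 'X : {poly 'F_l}) != 0.
  by rewrite -opprB oppr_eq0 polyXsubC_eq0.
apply: (mulfI X1_neq0); rewrite -exprS prednK ?prime_gt0 //.
have -> : (1 - 'X) * \sum_(i < l) 'X^i = 1 - 'X^l :> {poly 'F_l}.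
  by rewrite -opprB mulNr -subrX1 opprB.
have l_char : l \in [pchar {poly 'F_l}] by rewrite pchar_lalg pchar_Fp.
by rewrite -(pFrobenius_autE l_char) rmorphB /= pFrobenius_aut1 pFrobenius_autE.
Qed.

(* [Z] and [F] stand for the actions of zeta and of the Frobenius map on the  *)
(* Jacobian.                                                                  *)
Section FrobeniusFixed.

Variables (A : zmodType) (l q : nat) (Z F : {additive A -> A}).
(** These hypotheses are what the curve has to provide; [w] stands for the class of a branch point
    minus infinity, and [d] for the length of its Frobenius orbit. *)
Hypotheses (l_prime : prime l) (FZ : forall v, F (Z v) = iter q Z (F v)).
Hypothesis sumZ : forall v, \sum_(i < l) iter i Z v = 0.
Variables (w : A) (d : nat).
Hypotheses (d_gt0 : (0 < d)%N) (Zw : Z w = w) (Fdw : iter d F w = w).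
Hypothesis kerZ : forall v, Z v = v ->
  exists n : nat -> int, v = \sum_(i < d) iter i F w *~ n i.

Local Notation T := (tors A l).

Definition Zt : {linear T -> T} := tors_map Z.
Definition Ft : {linear T -> T} := tors_map F.
Definition Dt (v : T) : T := v - Zt v.

Fact Dt_linear : linear Dt.
Proof. by move=> a u v; rewrite /Dt linearP scalerBr opprD addrACA. Qed.
HB.instance Definition _ := GRing.isLinear.Build 'F_l T T *:%R Dt Dt_linear.

Lemma torsionP (v : A) : torsion l v <-> v \in Fl_torsion l.
Proof. by rewrite inE Fp_cast //; split=> /eqP. Qed.

(** On a vector fixed by [Z] the orbit sum is multiplication by l. *)
Lemma ker_torsion v : Z v = v -> torsion l v.
Proof.
move=> Zv; rewrite /torsion -[RHS](sumZ v) -[l in LHS]card_ord -sumr_const.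
by apply: eq_bigr => i _; elim: (i : nat) => //= n <-.
Qed.

Lemma iter_Dt n v : iter n Dt v = poly_act Zt ((1 - 'X) ^+ n) v.
Proof.
elim: n => [|n IH] /=; first by rewrite expr0 poly_actC scale1r.
rewrite exprS poly_actM -IH -opprB -scaleN1r poly_actZ poly_act_XsubC.
by rewrite scale1r scaleN1r opprB.
Qed.

(** By [exprB1_Fl], (1 - zeta)^(l-1) acts on the torsion as the orbit sum of zeta. *)
Lemma Dt_nil v : iter l.-1 Dt v = 0.
Proof.
rewrite iter_Dt exprB1_Fl //; apply: telt_inj;
  rewrite raddf0 -[RHS](sumZ (telt v)).
rewrite (@poly_act_wide _ _ _ l); last first.
  by apply: leq_trans (size_sum _ _ _) _; apply/bigmax_leqP => i _;
    rewrite size_polyXn.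
rewrite raddf_sum; apply: eq_bigr => i _ /=.
rewrite coef_sum (bigD1 i) //= coefXn eqxx big1 ?addr0.
  by rewrite scale1r telt_iter_map.
move=> h neq; rewrite coefXn; case: eqP => // /val_inj ih.
by rewrite ih eqxx in neq.
Qed.

(** The quotient of 1 - X^q by 1 - X. Its value q at X = 1 is the source of the powers of q among
    the eigenvalues. *)
Definition St : {poly 'F_l} := \sum_(i < q) 'X^i.

Lemma Ft_Dt v : Ft (Dt v) = Dt (poly_act Zt St (Ft v)).
Proof.
rewrite -[RHS]/(iter 1 Dt _) iter_Dt expr1 -poly_actM.
have -> : (1 - 'X) * St = 1 - 'X^q :> {poly 'F_l}.
  by rewrite /St -opprB mulNr -subrX1 opprB.
rewrite poly_actD -[- 'X^q]scaleN1r poly_actZ poly_actC scale1r scaleN1r.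
rewrite /Dt linearB; congr (_ - _); apply: telt_inj.
by rewrite !telt_map FZ poly_actXn telt_iter_map telt_map.
Qed.

Lemma Ft_iter_Dt n v :
  Ft (iter n Dt v) = poly_act Zt (St ^+ n) (iter n Dt (Ft v)).
Proof.
elim: n v => [|n IH] v /=; first by rewrite poly_actC scale1r.
rewrite Ft_Dt IH -!poly_actM -exprS.
by rewrite [in RHS]/Dt linearB /= poly_act_comm.
Qed.

(** The kernel of 1 - zeta is the cyclic module generated by [w] under Frob, and X^d - 1 annihilates
    [w]; hence [cyclic_eigenspace] applies. *)
Lemma eigenspace c : exists v0 : T, forall v, Zt v = v -> Ft v = c *: v ->
  exists s, v = s *: v0.
Proof.
have w_tors : w \in Fl_torsion l by apply/torsionP/ker_torsion.
pose wt : T := Sub w w_tors.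
have p0_neq0 : 'X^d - 1%:P != 0 :> {poly 'F_l} by rewrite -size_poly_gt0
  size_XnsubC.
have p0w : poly_act Ft ('X^d - 1) wt = 0.
  rewrite poly_actD -scaleN1r poly_actZ (poly_actC _ 1) scale1r scaleN1r.
  apply/eqP; rewrite poly_actXn subr_eq0; apply/eqP/telt_inj.
  by rewrite telt_iter_map.
have [v0 v0P] := cyclic_eigenspace c p0_neq0 p0w.
exists v0 => v Zv Fv.
have ZFv : Z (telt v) = telt v by rewrite -telt_map -[tors_map Z v]/(Zt v) Zv.
have [p v_eq] : exists p, v = poly_act Ft p wt.
  have [n v_eq] := kerZ ZFv.
  exists (\poly_(i < d) (n i)%:~R); apply: telt_inj.
  rewrite (@poly_act_wide _ _ _ d) ?size_poly // raddf_sum /= v_eq.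
  apply: eq_bigr => i _; rewrite coef_poly ltn_ord scaler_int raddfMz /=
    telt_iter_map.
  by [].
by rewrite v_eq in Fv *; apply: v0P.
Qed.

(** An instance of [filtration_basis] for the subspace of Frob-fixed vectors, once the counted
    indices are recognised as the jumps of its filtration by the kernels of the powers of [Dt]. *)
Theorem Frobenius_fixed_dim : is_dim_Fl l (fun v : A => torsion l v /\ F v = v)
  #|[set k : 'I_l | (1 <= k <= l - 1)%N &&
       `[< exists v : A, F_ l q F Z (k%:Z - 1) k v /\ eigenvector l F v >]]|.
Proof.
set S := [set k | _].
have l_gt0 := prime_gt0 l_prime.
have teltP (v : A) : torsion l v -> exists u : T, telt u = v.
  by move/torsionP=> v_tors; exists (Sub v v_tors); apply: SubK.
have telt_torsion (u : T) : torsion l (telt u) by apply/torsionP;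
  exact: (valP u).
have telt_Dt n u : telt (iter n Dt u) = iter n (fun v => v - Z v) (telt u).
  by elim: n => //= n IH; rewrite raddfB /= telt_map IH.
have telt_eq0 (u : T) : telt u = 0 <-> u = 0.
  by split=> [u0|->]; [apply: telt_inj|]; rewrite raddf0.
have telt_fix (u : T) : F (telt u) = telt u <-> Ft u = u.
  by rewrite -telt_map; split=> [/telt_inj|->].
have inS (k : 'I_l) : reflect ((0 < k)%N /\
    exists u : T, [/\ Ft u = u, iter k Dt u =
      0 & iter k.-1 Dt u != 0]) (k \in S).
  rewrite inE; have -> : (1 <= k <= l - 1)%N = (0 < k)%N.
    by rewrite leq_subRL // add1n ltn_ord andbT.
  have c_eq1 : q%:R ^ (k%:Z - 1 - k%:Z + 1) = 1 :> 'F_l.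
    by rewrite addrAC subrK subrr.
  apply: (iffP andP) => -[k_gt0].
    case/asboolP=> v [[Vk Vk1 [i i_gt0 gen]] [/teltP[u uv] v_neq0 [c Fc]]].
    split=> //; exists u; rewrite -uv in Vk Vk1 gen v_neq0 Fc.
    split; last 2 first.
    - by apply/telt_eq0; rewrite telt_Dt.
    - by apply/eqP => u0; apply: Vk1; rewrite /V_ -telt_Dt u0 raddf0.
    have u_neq0 : u != 0 by apply: contra v_neq0 => /eqP->; rewrite raddf0.
    have Fu : Ft u = c *: u by apply: telt_inj; rewrite telt_map Fc teltZ.
    (* The scalar in [F_] is q^0 = 1, so on an eigenvector of eigenvalue c the iterate is (c - 1)^i;
       its vanishing forces c = 1. *)
    have gen_u : iter i (fun w =>
      F w - Fl_scale (q%:R ^ (k%:Z - 1 - k%:Z + 1) :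
        'F_l) w) (telt u) = telt ((c - 1) ^+ i *: u).
      rewrite c_eq1; elim: (i) => [|n IH] /=; first by rewrite scale1r.
      rewrite IH -teltZ -telt_map -raddfB /=; congr telt.
      rewrite scale1r exprS -scalerA scalerBl scale1r; congr (_ - _).
      by rewrite linearZ /= Fu scalerA mulrC -scalerA.
    move: gen; rewrite gen_u => /telt_eq0/eqP.
    rewrite scaler_eq0 (negPf u_neq0) orbF expf_eq0 i_gt0 subr_eq0 => /eqP c1.
    by rewrite Fu c1 scale1r.
  case=> u [Fu Du Du1]; split=> //; apply/asboolP; exists (telt u).
  split; split.
  - by rewrite /V_ -telt_Dt Du raddf0.
  - by rewrite /V_ -telt_Dt => /telt_eq0/eqP; rewrite (negPf Du1).
  - exists 1%N => //=; rewrite c_eq1 -teltZ scale1r; apply/eqP.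
    by rewrite subr_eq0; apply/eqP/telt_fix.
  - exact: telt_torsion.
  - apply: contra Du1 => /eqP/telt_eq0 ->.
    by apply/eqP; elim: k.-1 => //= n ->; rewrite linear0.
  - by exists 1; rewrite -teltZ scale1r; apply/telt_fix.
have choose_e (k : 'I_l) : {u :
  T | k \in S -> [/\ Ft u = u, iter k Dt u = 0 & iter k.-1 Dt u != 0]}.
  apply: cid; case: (inS k) => [[_ [u uP]]|_]; first by exists u.
  by exists 0.
pose e k := sval (choose_e k).
have eP k : k \in S -> [/\ Ft (e k) = e k, iter k Dt (e k) =
  0 & iter k.-1 Dt (e k) != 0].
  by move=> kS; apply: (svalP (choose_e k)).
have basis := @filtration_basis _ _ Dt (fun u => Ft u = u) l S e.
exists (fun i => telt (e (enum_val i))); split=> [i|v [/teltP[u <-] Fv]].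
  by split=> //; apply/telt_fix; case: (eP _ (enum_valP i)).
have [|||||c [u_eq c_uniq]] := basis _ _ _ _ u _.
- by move=> a x y Fx Fy; rewrite linearP Fx Fy.
- by move=> x _; apply: Dt_nil.
- by move=> i iS; have [i_gt0 _] := inS i iS; have [] := eP i iS.
- move=> i x i_gt0 Fx Dx; case: (boolP (i \in S)) => [iS|iNS]; last first.
    apply/eqP/negPn/negP => Dx1; case/inS: iNS; split=> //.
    by exists x.
  (* Moving Frob across D^(i-1) costs the operator [St] to the power i - 1, which acts on the kernel
     of D through its value q^(i-1) at X = 1. *)
  have top y : Ft y = y -> iter i Dt y = 0 ->
      Zt (iter i.-1 Dt y) = iter i.-1 Dt y /\
      Ft (iter i.-1 Dt y) = q%:R ^+ i.-1 *: iter i.-1 Dt y.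
    move=> Fy; rewrite -{1}(prednK i_gt0) /= {1}/Dt => /eqP.
    rewrite subr_eq0 eq_sym => /eqP Zy; split=> //.
    rewrite Ft_iter_Dt Fy (@poly_act_eigen _ _ _ _ 1) ?scale1r //.
    rewrite horner_exp horner_sum; congr (_ ^+ _ *: _).
    under eq_bigr do rewrite hornerXn expr1n.
    by rewrite sumr_const card_ord.
  have [Fe De De1] := eP i iS.
  have [v0 v0P] := eigenspace (q%:R ^+ i.-1).
  have [a Dx_eq] := v0P _ (top x Fx Dx).1 (top x Fx Dx).2.
  have [b De_eq] := v0P _ (top _ Fe De).1 (top _ Fe De).2.
  (* [a] and [b] are the coordinates of D^(i-1) x and D^(i-1) (e i) on the line of [v0]; the second
     vector is nonzero, so b is too. *)
  exists (a / b); rewrite -scaleNr addrC iter_linearP Dx_eq De_eq scalerA.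
  rewrite mulNr divfK ?scaleNr ?addNr //.
  by apply: contra De1 => /eqP b0; rewrite De_eq b0 scale0r.
- exact/telt_fix.
have telt_comb (c' : {ffun 'I_#|S| -> 'F_l}) :
    telt (\sum_(i < #|S|) c' i *: e (enum_val i)) =
      \sum_(i < #|S|) Fl_scale (c' i) (telt (e (enum_val i))).
  by rewrite raddf_sum; apply: eq_bigr => i _; rewrite /= teltZ.
exists c; split; first by rewrite -telt_comb -u_eq.
by move=> c' v_eq; apply: c_uniq; apply: telt_inj; rewrite telt_comb.
Qed.

End FrobeniusFixed.

(** * Places and direct images of divisors *)

Section Places.

Variables (K L : fieldType) (j : {rmorphism K -> L}).
Local Notation place := (place j).
Implicit Types (P Q : place) (g h : L).

Definition mk_place (v : L -> int) (vP : is_place j v) : place :=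
  exist (fun v => `[< is_place j v >]) v (asboolT vP).

Lemma ord_zero P : ord P 0 = 0.
Proof. by case/asboolP: (valP P). Qed.

Lemma ordC P a : ord P (j a) = 0.
Proof.
have [->|a0] := eqVneq a 0; first by rewrite rmorph0 ord_zero.
by case/asboolP: (valP P) => _ vK _ _ _; apply: vK.
Qed.

Lemma ordV P g : ord P g^-1 = - ord P g.
Proof.
have [->|g0] := eqVneq g 0; first by rewrite invr0 ord_zero.
by apply/eqP; rewrite -addr_eq0 -(ordM P (invr_neq0 g0) g0) mulVf // Defs.ord1.
Qed.

Lemma ordX P g n : ord P (g ^+ n) = ord P g *+ n.
Proof.
have [->|g0] := eqVneq g 0.
  by case: n => [|n]; rewrite ?Defs.ord1 // expr0n /= !ord_zero mul0rn.
by elim: n => [|n IH]; rewrite ?Defs.ord1 // exprS ordM ?expf_neq0 // IH mulrS.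
Qed.

Lemma ord_expz P g (n : int) : ord P (g ^ n) = ord P g *~ n.
Proof.
case: n => n; first exact: ordX.
by rewrite NegzE -exprnN ordV ordX mulrNz.
Qed.

Lemma ordN P g : ord P (- g) = ord P g.
Proof.
have [->|g0] := eqVneq g 0; first by rewrite oppr0.
by rewrite -mulN1r ordM ?oppr_eq0 ?oner_eq0 // -(rmorphN1 j) ordC add0r.
Qed.

Lemma ord_prod P (I : Type) (r : seq I) (R : pred I) (G : I -> L) :
  (forall i, R i -> G i != 0) ->
  ord P (\prod_(i <- r | R i) G i) = \sum_(i <- r | R i) ord P (G i).
Proof.
move=> G0; elim: r => [|i r IH]; first by rewrite !big_nil Defs.ord1.
rewrite !big_cons; case: ifP => // Ri; rewrite ordM ?IH ?G0 //.
by elim/big_ind: _ => [|g h g0 h0|//]; rewrite ?oner_eq0 ?mulf_neq0.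
Qed.

Lemma uniformizer P : exists2 t, t != 0 & ord P t = 1.
Proof. by case/asboolP: (valP P). Qed.

Lemma ordD_ge0 P g h : 0 <= ord P g -> 0 <= ord P h -> 0 <= ord P (g + h).
Proof.
have [->|g0] := eqVneq g 0; first by rewrite add0r.
have [->|h0] := eqVneq h 0; first by rewrite addr0.
have [->|gh0] := eqVneq (g + h) 0; first by rewrite ord_zero.
move=> Pg Ph; case/asboolP: (valP P) => _ _ _ vD _.
by apply: le_trans (vD g h g0 h0 gh0); rewrite le_min Pg.
Qed.

Lemma ordM_ge0 P g h : 0 <= ord P g -> 0 <= ord P h -> 0 <= ord P (g * h).
Proof.
have [->|g0] := eqVneq g 0; first by rewrite mul0r ord_zero.
have [->|h0] := eqVneq h 0; first by rewrite mulr0 ord_zero.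
by rewrite ordM //; apply: addr_ge0.
Qed.

(* As ord P 0 = 0 by convention, the maximal ideal needs a separate case.     *)
Definition vanish P g := (g == 0) || (0 < ord P g).

Lemma vanish0 P : vanish P 0.
Proof. by rewrite /vanish eqxx. Qed.

Lemma vanish_ge0 P g : vanish P g -> 0 <= ord P g.
Proof. by case/orP=> [/eqP->|/ltW//]; rewrite ord_zero. Qed.

Lemma vanishD P g h : vanish P g -> vanish P h -> vanish P (g + h).
Proof.
rewrite /vanish; have [->|g0] := eqVneq g 0; first by rewrite add0r.
have [->|h0] := eqVneq h 0; first by rewrite addr0 (negPf g0).
have [->|gh0] //= := eqVneq (g + h) 0.
move=> Pg Ph; case/asboolP: (valP P) => _ _ _ vD _.
by apply: lt_le_trans (vD g h g0 h0 gh0); rewrite lt_min Pg.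
Qed.

Lemma vanishM P g h : vanish P g -> 0 <= ord P h -> vanish P (g * h).
Proof.
rewrite /vanish; have [->|g0] := eqVneq g 0; first by rewrite mul0r eqxx.
have [->|h0] := eqVneq h 0; first by rewrite mulr0 eqxx.
by rewrite ordM // mulf_eq0 (negPf g0) (negPf h0) /=; apply: ltr_pwDl.
Qed.

Lemma vanishN P g : vanish P (- g) = vanish P g.
Proof. by rewrite /vanish oppr_eq0 ordN. Qed.

Lemma vanishC P a : vanish P (j a) = (a == 0).
Proof. by rewrite /vanish fmorph_eq0 ordC ltxx orbF. Qed.

Lemma vanish_subC P g a b : vanish P (g - j a) -> vanish P (g - j b) -> a = b.
Proof.
move=> Pa; rewrite -vanishN => Pb; apply/esym/eqP;
  rewrite -subr_eq0 -(vanishC P).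
suff -> : j (b - a) = (g - j a) + - (g - j b) by apply: vanishD.
by rewrite rmorphB; ring.
Qed.

Lemma vanishX P g n : (0 < n)%N -> vanish P (g ^+ n) = vanish P g.
Proof.
by move=> n_gt0; rewrite /vanish expf_eq0 n_gt0 ordX pmulrn_lgt0.
Qed.

Lemma vanish_prod P (I : Type) (r : seq I) (G : I -> L) :
  vanish P (\prod_(i <- r) G i) -> exists2 i, List.In i r & vanish P (G i).
Proof.
elim: r => [|i r IH]; first by rewrite big_nil -(rmorph1 j) vanishC oner_eq0.
rewrite big_cons => Pp; have [Pi|NPi] := boolP (vanish P (G i)).
  by exists i => //; left.
have [|i1 ? ?] := IH; last by exists i1 => //; right.
move: Pp NPi; rewrite /vanish mulf_eq0; have [->|Gi0] //= := eqVneq (G i) 0.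
case: eqVneq => //= p0; rewrite ordM // => P0 nP.
rewrite -leNgt in nP; by apply: lt_le_trans P0 _; rewrite gerDr.
Qed.

Lemma place_ext P Q : (forall g, ord P g = ord Q g) -> P = Q.
Proof. by move=> PQ; apply/val_inj/funext. Qed.

(** Equal valuation rings have equal units, so ord Q is ord Q t times ord P for [t] a uniformizer at
    P; normalisation of Q forces ord Q t = 1. *)
Lemma place_eq P Q : (forall g, (0 <= ord P g) = (0 <= ord Q g)) -> P = Q.
Proof.
move=> PQ.
have unitPQ g : g != 0 -> ord P g = 0 -> ord Q g = 0.
  move=> g0 Pg; apply/eqP; rewrite eq_le -PQ Pg lexx andbT.
  by rewrite -oppr_ge0 -ordV -PQ ordV Pg.
have [t t0 Pt] := uniformizer P; have [s s0 Qs] := uniformizer Q.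
have Qord g : g != 0 -> ord Q g = ord Q t *~ ord P g.
  move=> g0; apply/eqP; rewrite -subr_eq0 -mulrNz -ord_expz -ordM ?expfz_neq0
    //.
  apply/eqP/unitPQ; first by rewrite mulf_neq0 ?expfz_neq0.
  by rewrite ordM ?expfz_neq0 // ord_expz Pt mulrNz intz subrr.
have Qt_ge0 : 0 <= ord Q t by rewrite -PQ Pt.
have Qt : ord Q t = 1.
  have := Qord s s0; rewrite Qs -mulrzr intz => /esym/eqP.
  case: (ord Q t) Qt_ge0 => // n _; case: (ord P s) => m.
    by rewrite -PoszM => /eqP[] /eqP; rewrite muln_eq1 => /andP[/eqP->].
  by rewrite NegzE mulrN -PoszM; case: (n * m.+1)%N.
apply: place_ext => g; have [->|g0] := eqVneq g 0; first by rewrite !ord_zero.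
by rewrite Qord // Qt -mulrzr intz mul1r.
Qed.

(** By [place_eq] at most one place has the property defining [place_image], so once one exists the
    default is not taken. *)
Lemma place_imageE theta P Q :
  (forall g, (0 <= ord Q g) =
    (0 <= ord P (theta g))) -> place_image theta P = Q.
Proof.
move=> Qth; apply: place_eq => g; rewrite Qth; move: g.
exact: (@xgetPex _ P [set Q : place |
    forall g, (0 <= ord Q g) = (0 <= ord P (theta g))]%classic (ex_intro _ Q
      Qth)).
Qed.

Lemma eq_place_image theta theta' P :
  (forall g, (0 <= ord P (theta g)) = (0 <= ord P (theta' g))) ->
  place_image theta P = place_image theta' P.
Proof.
by move=> th; congr xget; apply/seteqP; split=> Q /= Qth g; rewrite Qth th.
Qed.

Section Automorphism.

Variable theta : {rmorphism L -> L}.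

(** An automorphism of L mapping K onto itself but possibly moving constants, as the arithmetic
    Frobenius does. Injectivity is automatic for a morphism of fields. *)
Definition const_auto := (forall g, exists h, theta h = g) /\
  (forall a, exists b, theta (j a) = j b) /\
  (forall a, exists b, theta (j b) = j a).

Hypothesis thetaP : const_auto.

Lemma ord_place_image P g : ord (place_image theta P) g = ord P (theta g).
Proof.
have [th_surj [th_j _]] := thetaP.
have vP : is_place j (fun g => ord P (theta g)).
  split=> [|a a0|g1 g2 g10 g20|g1 g2 g10 g20 g120|].
  - by rewrite rmorph0 ord_zero.
  - by have [b ->] := th_j a; rewrite ordC.
  - by rewrite rmorphM ordM ?fmorph_eq0.
  - case/asboolP: (valP P) => _ _ _ vD _.
    by rewrite rmorphD; apply: vD; rewrite -?rmorphD fmorph_eq0.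
  have [t t0 Pt] := uniformizer P; have [h th] := th_surj t.
  by exists h; rewrite ?th // -(fmorph_eq0 theta) th.
by rewrite (@place_imageE theta P (mk_place vP)).
Qed.

Lemma place_image_inj : injective (@place_image _ _ j theta).
Proof.
have [th_surj _] := thetaP.
move=> P Q PQ; apply: place_ext => g; have [h <-] := th_surj g.
by rewrite -!ord_place_image PQ.
Qed.

(** The preimage is the valuation of Q composed with the inverse of [theta], which is obtained by
    choice. *)
Lemma place_image_surj Q : exists P, place_image theta P = Q.
Proof.
have [th_surj [_ th_j]] := thetaP.
pose inv g := xget 0 [set h | theta h = g]%classic.
have invK g : theta (inv g) = g by apply: (xgetPex 0 (th_surj g)).
have invM g h : inv (g * h) = inv g * inv h.
  by apply: (fmorph_inj theta); rewrite rmorphM !invK.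
have invD g h : inv (g + h) = inv g + inv h.
  by apply: (fmorph_inj theta); rewrite rmorphD !invK.
have inv_eq0 g : (inv g == 0) =
  (g == 0) by rewrite -(fmorph_eq0 theta (inv g)) invK.
have invj a : exists b, inv (j a) = j b.
  by have [b ab] := th_j a; exists b; apply: (fmorph_inj theta); rewrite invK.
have vP : is_place j (fun g => ord Q (inv g)).
  split=> [|a a0|g1 g2 g10 g20|g1 g2 g10 g20 g120|].
  - by have /eqP -> : inv 0 == 0; rewrite ?inv_eq0 ?ord_zero.
  - by have [b ->] := invj a; rewrite ordC.
  - by rewrite invM ordM ?inv_eq0.
  - case/asboolP: (valP Q) => _ _ _ vD _.
    by rewrite invD; apply: vD; rewrite -?invD inv_eq0.
  have [t t0 Qt] := uniformizer Q; exists (theta t);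
    first by rewrite fmorph_eq0.
  by have -> : inv (theta t) = t by apply: (fmorph_inj theta); rewrite invK.
exists (mk_place vP); apply: place_ext => g.
rewrite ord_place_image; congr (ord Q _).
by apply: (fmorph_inj theta); rewrite invK.
Qed.

End Automorphism.

End Places.

Section Divisors.

Variables (K L : fieldType) (j : {rmorphism K -> L}).
Local Notation place := (place j).
Local Notation divisor := {freeg place / int}.
Local Notation J := (jacobian j).
Local Notation principal := (@principal _ _ j).
Implicit Types (P Q : place) (g h : L).

Lemma divisor_ext (D E : divisor) : (forall P, coeff P D = coeff P E) -> D = E.
Proof. by move=> DE; apply/eqP/freeg_eqP. Qed.

Section Push.

Variable theta : L -> L.

(** Expressing the direct image as a linear extension from points gives its additivity. *)
Lemma push_div_lift D :
  push_div theta D = fglift (fun P => << place_image theta P >> : divisor) D.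
Proof.
rewrite -[D in RHS]Freeg_dom fglift_Freeg /prelift big_map.
apply: eq_bigr => P _ /=; apply: divisor_ext => Q.
by rewrite coeffZ !coeffU mul1r.
Qed.

Fact push_div_is_zmod_morphism : zmod_morphism (@push_div _ _ j theta).
Proof. by move=> D E; rewrite !push_div_lift; apply: lift_is_additive. Qed.
HB.instance Definition _ := GRing.isZmodMorphism.Build divisor divisor
  (@push_div _ _ j theta) push_div_is_zmod_morphism.

Lemma push_divU k P :
  push_div theta << k *g P >> = << k *g place_image theta P >>.
Proof.
rewrite push_div_lift liftU; apply: divisor_ext => Q.
by rewrite coeffZ !coeffU mul1r.
Qed.

Lemma val_push_div0 (D : div0 j) :
  val (push_div0 theta D) = push_div theta (val D).
Proof.
apply: insubdK; rewrite inE deg_push_div.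
exact: (valP D).
Qed.

Fact push_div0_is_zmod_morphism : zmod_morphism (@push_div0 _ _ j theta).
Proof.
by move=> D E; apply: val_inj; rewrite val_push_div0 !raddfB /= !val_push_div0.
Qed.
HB.instance Definition _ := GRing.isZmodMorphism.Build (div0 j) (div0 j)
  (@push_div0 _ _ j theta) push_div0_is_zmod_morphism.

End Push.

Lemma piE (D E : div0 j) : (\pi_J D == \pi_J E) = (D - E \in principal).
Proof. by rewrite -Quotient.equivE eqmodE. Qed.

Lemma pi_eq0 (D : div0 j) : (\pi_J D == 0) = (D \in principal).
Proof. by have := piE D 0; rewrite subr0 raddf0. Qed.

Section PushAuto.

Variable theta : {rmorphism L -> L}.
Hypothesis thetaP : const_auto j theta.

Lemma coeff_push_div D P :
  coeff (place_image theta P) (push_div theta D) = coeff P D.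
Proof.
rewrite -[D in LHS]freeg_sumE -[D in RHS]freeg_sumE [push_div _ _]raddf_sum
  !(raddf_sum (coeff _)).
apply: eq_bigr => Q _ /=.
by rewrite push_divU !coeffU (inj_eq (place_image_inj thetaP)).
Qed.

Lemma push_principal D : D \in principal -> push_div0 theta D \in principal.
Proof.
move=> /principalP[g g0 Dg]; apply/principalP.
have [th_surj _] := thetaP; have [h hg] := th_surj g.
exists h => [|Q]; first by rewrite -(fmorph_eq0 theta) hg.
have [P <-] := place_image_surj thetaP Q.
by rewrite val_push_div0 coeff_push_div Dg ord_place_image // hg.
Qed.

Lemma push_pi D : push theta (\pi_J D) = \pi_J (push_div0 theta D).
Proof.
apply/eqP; rewrite /push piE -raddfB; apply: push_principal.
by rewrite -piE reprK.
Qed.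

Lemma push_is_zmod_morphism : zmod_morphism (push theta : J -> J).
Proof.
move=> u v; elim/quotW: u => D; elim/quotW: v => E.
have -> : \pi_J D - \pi_J E = \pi_J (D - E) by rewrite raddfB.
by rewrite !push_pi !raddfB.
Qed.

End PushAuto.

Lemma eq_push (theta theta' : L -> L) :
  (forall P, place_image theta P = place_image theta' P) ->
  push theta =1 push theta' :> (J -> J).
Proof.
move=> eq_pi u; congr (\pi_J _); apply: val_inj; rewrite !val_push_div0.
by apply: eq_bigr => P _; rewrite eq_pi.
Qed.

End Divisors.

(** * Kummer models of function fields *)

Section Evaluation.

Variables (K L : fieldType) (j : {rmorphism K -> L}) (x y : L).

Definition ev1 (p : {poly K}) : L := (map_poly j p).[x].

Fact ev1_is_zmod_morphism : zmod_morphism ev1.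
Proof. by move=> p q; rewrite /ev1 rmorphB hornerD hornerN. Qed.
Fact ev1_is_monoid_morphism : monoid_morphism ev1.
Proof. by split=> [|p q]; rewrite /ev1 ?rmorph1 ?hornerC // rmorphM hornerM.
  Qed.
HB.instance Definition _ :=
  GRing.isZmodMorphism.Build {poly K} L ev1 ev1_is_zmod_morphism.
HB.instance Definition _ :=
  GRing.isMonoidMorphism.Build {poly K} L ev1 ev1_is_monoid_morphism.

(* The outer indeterminate is sent to y, the inner one to x.                  *)
Definition ev2 (P : {poly {poly K}}) : L := (map_poly ev1 P).[y].

Fact ev2_is_zmod_morphism : zmod_morphism ev2.
Proof. by move=> p q; rewrite /ev2 rmorphB hornerD hornerN. Qed.
Fact ev2_is_monoid_morphism : monoid_morphism ev2.
Proof. by split=> [|p q]; rewrite /ev2 ?rmorph1 ?hornerC // rmorphM hornerM.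
  Qed.
HB.instance Definition _ :=
  GRing.isZmodMorphism.Build {poly {poly K}} L ev2 ev2_is_zmod_morphism.
HB.instance Definition _ :=
  GRing.isMonoidMorphism.Build {poly {poly K}} L ev2 ev2_is_monoid_morphism.

Lemma ev1C c : ev1 c%:P = j c.
Proof. by rewrite /ev1 map_polyC hornerC. Qed.
Lemma ev1X : ev1 'X = x.
Proof. by rewrite /ev1 map_polyX hornerX. Qed.
Lemma ev1_XsubC a : ev1 ('X - a%:P) = x - j a.
Proof. by rewrite rmorphB /= ev1X ev1C. Qed.
Lemma ev2C p : ev2 p%:P = ev1 p.
Proof. by rewrite /ev2 map_polyC hornerC. Qed.
Lemma ev2X : ev2 'X = y.
Proof. by rewrite /ev2 map_polyX hornerX. Qed.

Lemma ev2D P Q : ev2 (P + Q) = ev2 P + ev2 Q.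
Proof. exact: (rmorphD ev2). Qed.
Lemma ev2B P Q : ev2 (P - Q) = ev2 P - ev2 Q.
Proof. exact: (rmorphB ev2). Qed.
Lemma ev2M P Q : ev2 (P * Q) = ev2 P * ev2 Q.
Proof. exact: (rmorphM ev2). Qed.
Lemma ev2Xn P n : ev2 (P ^+ n) = ev2 P ^+ n.
Proof. exact: (rmorphXn ev2). Qed.

Lemma ev2_wide n (P : {poly {poly K}}) :
  (size P <= n)%N -> ev2 P = \sum_(i < n) ev1 P`_i * y ^+ i.
Proof.
move=> le_Pn; rewrite /ev2 (@horner_coef_wide _ n) ?(leq_trans (size_poly _ _))
  //.
by apply: eq_bigr => i _; rewrite coef_map.
Qed.

Lemma ev2_ind (S : L -> Prop) :
  (forall c, S (j c)) -> S x -> S y -> (forall g h, S g -> S h -> S (g + h)) ->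
  (forall g h, S g -> S h -> S (g * h)) -> forall P, S (ev2 P).
Proof.
move=> Sj Sx Sy SD SM.
have S1 p : S (ev1 p).
  elim/poly_ind: p => [|p c IH]; first by rewrite raddf0 -(rmorph0 j).
  by rewrite rmorphD rmorphM /= ev1X ev1C; apply: SD => //; apply: SM.
elim/poly_ind => [|p c IH]; first by rewrite raddf0 -(rmorph0 j).
by rewrite rmorphD rmorphM /= ev2X ev2C; apply: SD => //; apply: SM.
Qed.

End Evaluation.

(** With L = K and the identity embedding, the same maps evaluate polynomials at K-points, so that
    one set of morphism lemmas serves for functions and for their values. *)
Notation pt1 := (ev1 idfun).
Notation pt2 := (ev2 idfun).

Lemma pt1E (K : fieldType) (a : K) p : pt1 a p = p.[a].
Proof. by rewrite /ev1 map_poly_id. Qed.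

Lemma iter_rmorphM (R : nzRingType) (f : {rmorphism R -> R}) k :
  {morph iter k f : u v / u * v}.
Proof. by elim: k => [//|k IH] u v; rewrite !iterS IH rmorphM. Qed.

Lemma iter_rmorphD (R : nzRingType) (f : {rmorphism R -> R}) k :
  {morph iter k f : u v / u + v}.
Proof. by elim: k => [//|k IH] u v; rewrite !iterS IH rmorphD. Qed.

Lemma iter_rmorph_sum (R : nzRingType) (f : {rmorphism R -> R}) k n (G :
  'I_n -> R) :
  iter k f (\sum_(i < n) G i) = \sum_(i < n) iter k f (G i).
Proof. by elim: k => //= k ->; rewrite rmorph_sum. Qed.

Lemma iter_rmorphV (R : fieldType) (f : {rmorphism R -> R}) k :
  {morph iter k f : u / u^-1}.
Proof. by elim: k => [//|k IH] u; rewrite !iterS IH fmorphV. Qed.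

Lemma iter_fmorph_eq0 (R : fieldType) (f : {rmorphism R -> R}) k u :
  (iter k f u == 0) = (u == 0).
Proof. by elim: k => //= k IH; rewrite fmorph_eq0. Qed.

Lemma sum_expr_unity (R : fieldType) (u : R) n : u ^+ n = 1 ->
  \sum_(k < n) u ^+ k = if u == 1 then n%:R else 0.
Proof.
move=> un; case: eqVneq => [->|u1].
  by under eq_bigr do rewrite expr1n; rewrite sumr_const card_ord.
apply: (mulfI (x := u - 1)); first by rewrite subr_eq0.
by rewrite -subrX1 un subrr mulr0.
Qed.

(** The coordinates, the polynomial and the root of unity are parameters because the same [zetaL] is
    also described by a second model, in the chart at infinity. *)
Record kummer (K L : fieldType) (j : {rmorphism K -> L}) (l : nat)
    (h : {poly K}) (x y : L) (zeta : K) (zetaL : L -> L) : Prop := Kummer {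
  kummer_trans : ~ algebraicOver j x;
  kummer_eq : y ^+ l = ev1 j x h;
  kummer_neq0 : y != 0;
  kummer_gen : forall g, exists P Q, ev2 j x y Q != 0 /\ g =
    ev2 j x y P / ev2 j x y Q;
  kummer_root : l.-primitive_root zeta;
  kummer_char : l%:R != 0 :> K;
  kummer_fixC : forall a, zetaL (j a) = j a;
  kummer_fixX : zetaL x = x;
  kummer_act : zetaL y = j zeta * y }.

Section Kummer.

Variables (K L : fieldType) (j : {rmorphism K -> L}) (l : nat).
Variables (h : {poly K}) (x y : L) (zeta : K) (zetaL : {rmorphism L -> L}).
Hypothesis model : kummer j l h x y zeta zetaL.

Local Notation ev1 := (ev1 j x).
Local Notation ev2 := (ev2 j x y).

Let l_gt0 : (0 < l)%N := prim_order_gt0 (kummer_root model).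
Let zeta_l : zeta ^+ l = 1 := prim_expr_order (kummer_root model).
Let zeta_neq0 : zeta != 0.
Proof.
by apply/eqP => z0; move/eqP: zeta_l;
  rewrite z0 expr0n eqn0Ngt l_gt0 eq_sym oner_eq0.
Qed.

Lemma ev1_eq0 p : (ev1 p == 0) = (p == 0).
Proof.
apply/idP/eqP => [p_x|->]; last by rewrite raddf0.
by apply: contrapT => /eqP p0; apply: (kummer_trans model); exists p.
Qed.

Lemma fun_field_ind (S : L -> Prop) :
  (forall c, S (j c)) -> S x -> S y -> (forall g h, S g -> S h -> S (g + h)) ->
  (forall g h, S g -> S h -> S (g * h)) -> (forall g, S g -> S g^-1) ->
  forall g, S g.
Proof.
move=> Sj Sx Sy SD SM SV g; have [P [Q [_ ->]]] := kummer_gen model g.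
by have SE := ev2_ind Sj Sx Sy SD SM; apply: SM; [|apply: SV]; apply: SE.
Qed.

(** The substitution of zeta^k Y for the outer indeterminate Y, which lifts the k-th iterate of
    [zetaL] to polynomials. *)
Definition twist k (P : {poly {poly K}}) : {poly {poly K}} :=
  \poly_(i < size P) ((zeta ^+ (i * k))%:P * P`_i).

Lemma coef_twist k P i : (twist k P)`_i = (zeta ^+ (i * k))%:P * P`_i.
Proof. by rewrite coef_poly; case: ltnP => // /(nth_default 0)->;
  rewrite mulr0. Qed.

Lemma iter_zetaC k a : iter k zetaL (j a) = j a.
Proof. by elim: k => //= k ->; apply: (kummer_fixC model). Qed.

Lemma iter_zetaY k : iter k zetaL y = j (zeta ^+ k) * y.
Proof.
elim: k => [|k IH]; first by rewrite rmorph1 mul1r.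
by rewrite iterS IH rmorphM /= (kummer_fixC model) (kummer_act model) mulrA
  -rmorphM exprSr.
Qed.

Lemma iter_zetaYX k i : iter k zetaL (y ^+ i) = j (zeta ^+ (i * k)) * y ^+ i.
Proof.
elim: i => [|i IH]; first by rewrite expr0 -(rmorph1 j) iter_zetaC -rmorphM
  mulr1.
by rewrite exprS iter_rmorphM iter_zetaY IH mulSn exprD rmorphM /=; ring.
Qed.

Lemma iter_zeta_ev2 k P : iter k zetaL (ev2 P) = ev2 (twist k P).
Proof.
have z1 p : iter k zetaL (ev1 p) = ev1 p.
  have zx : iter k zetaL x = x by elim: k => //= k ->;
    rewrite (kummer_fixX model).
  rewrite /ev1 horner_coef iter_rmorph_sum; apply: eq_bigr => i _.
  rewrite iter_rmorphM coef_map iter_zetaC; congr (_ * _).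
  elim: (i : nat) => [|n IH]; first by rewrite expr0 -(rmorph1 j) iter_zetaC.
  by rewrite exprS iter_rmorphM zx IH.
rewrite (ev2_wide j x y (leqnn _)) (@ev2_wide _ _ j x y (size P)) ?size_poly //.
rewrite iter_rmorph_sum; apply: eq_bigr => i _;
  rewrite coef_twist rmorphM /= ev1C iter_rmorphM z1.
by rewrite iter_zetaYX mulrCA mulrA.
Qed.

Lemma zeta_ord k : iter l zetaL k = k.
Proof.
have [P [Q [Q0 ->]]] := kummer_gen model k.
have twl R : twist l R = R.
  by apply/polyP => i; rewrite coef_twist mulnC exprM zeta_l expr1n mul1r.
by rewrite iter_rmorphM iter_rmorphV !iter_zeta_ev2 !twl.
Qed.

Lemma zetaL_surj g : exists h, zetaL h = g.
Proof. by exists (iter l.-1 zetaL g); rewrite -iterS prednK // zeta_ord. Qed.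

Lemma zetaL_auto : const_auto j zetaL.
Proof.
by split; [exact: zetaL_surj | split=> a; exists a; apply: (kummer_fixC model)].
Qed.

Lemma zeta_ratio_eq1 (i i0 : 'I_l) : (zeta ^+ i / zeta ^+ i0 == 1) = (i == i0).
Proof.
rewrite -subr_eq0 -[1](divff (expf_neq0 i0 zeta_neq0)) -mulrBl mulf_eq0.
rewrite invr_eq0 (negPf (expf_neq0 _ zeta_neq0)) orbF subr_eq0.
by rewrite (eq_prim_root_expr (kummer_root model)) !modn_small.
Qed.

(* Fourier inversion for the group generated by zetaL.                        *)
Lemma ev2_component (P : {poly {poly K}}) (i0 : 'I_l) : (size P <= l)%N ->
  \sum_(k < l) j (zeta ^- (i0 * k)) * iter k zetaL (ev2 P)
    = l%:R * (ev1 P`_i0 * y ^+ i0).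
Proof.
move=> le_Pl.
rewrite (eq_bigr (fun k : 'I_l => \sum_(i < l)
    j (zeta ^- (i0 * k)) * (ev1 (twist k P)`_i * y ^+ i))); last first.
  move=> k _; rewrite iter_zeta_ev2 (@ev2_wide _ _ j x y l) ?mulr_sumr //.
  exact: leq_trans (size_poly _ _) le_Pl.
rewrite exchange_big (bigD1 i0) //= [X in _ + X]big1 ?addr0 => [|i neq_i].
  rewrite (eq_bigr (fun=> ev1 P`_i0 * y ^+ i0)) => [|k _].
    by rewrite sumr_const card_ord mulr_natl.
  rewrite coef_twist rmorphM /= ev1C !mulrA -rmorphM mulVf ?expf_neq0 //.
  by rewrite rmorph1 mul1r.
rewrite (eq_bigr (fun k : 'I_l =>
  j ((zeta ^+ i / zeta ^+ i0) ^+ k) * (ev1 P`_i * y ^+ i))).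
  rewrite -mulr_suml -rmorph_sum sum_expr_unity; last first.
    by rewrite expr_div_n -!exprM !(mulnC _ l) !exprM zeta_l !expr1n divr1.
  by rewrite zeta_ratio_eq1 (negPf neq_i) rmorph0 mul0r.
move=> k _; rewrite coef_twist rmorphM /= ev1C !mulrA -rmorphM;
  congr (j _ * _ * _).
by rewrite expr_div_n mulrC -!exprM.
Qed.

Let lL_neq0 : l%:R != 0 :> L.
Proof. by rewrite -(rmorph_nat j) fmorph_eq0 (kummer_char model). Qed.

(** The powers of y below l are independent over K(x): [ev2_component] isolates each coefficient,
    and l is invertible. *)
Lemma ev2_indep (P : {poly {poly K}}) : (size P <= l)%N -> ev2 P = 0 -> P = 0.
Proof.
move=> le_Pl P0; apply/polyP => i; rewrite coef0.
have [lt_il|le_li] := ltnP i l;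
  last by rewrite nth_default // (leq_trans le_Pl).
have := ev2_component (Ordinal lt_il) le_Pl; rewrite P0.
rewrite big1 => [|k _]; last first.
  by have /eqP -> : iter k zetaL 0 == 0; rewrite ?iter_fmorph_eq0 ?mulr0.
move/esym/eqP; rewrite !mulf_eq0 (negPf lL_neq0) (negPf (expf_neq0 _
  (kummer_neq0 model))).
by rewrite orbF /= ev1_eq0 => /eqP.
Qed.

Import Pdiv.CommonRing Pdiv.RingMonic.

(** Division by the monic Y^l - h, which vanishes both in L and at every point of the curve. *)
Lemma ev2_reduce P : exists R :
  {poly {poly K}}, [/\ (size R <= l)%N, ev2 P = ev2 R &
  forall a b, b ^+ l = h.[a] -> pt2 a b P = pt2 a b R].
Proof.
have [M M_def] : exists M :
  {poly {poly K}}, M = 'X^l - h%:P by exists ('X^l - h%:P).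
have M_monic : M \is monic by rewrite M_def monicXnsubC.
have evM0 : ev2 M = 0.
  by rewrite M_def ev2B ev2Xn  ev2X ev2C (kummer_eq model) subrr.
have pt2M a b : b ^+ l = h.[a] -> pt2 a b M = 0.
  by move=> ab; rewrite M_def ev2B ev2Xn ev2X ev2C pt1E ab subrr.
have := rdivp_eq M_monic P; have := ltn_rmodpN0 P (monic_neq0 M_monic).
rewrite {2}M_def (size_XnsubC h l_gt0); move: (rdivp P M) (rmodp P M).
move=> Q R le_Rl ->; exists R; split=> [//||a b ab].
  by rewrite ev2D ev2M evM0 mulr0 add0r.
by rewrite ev2D ev2M pt2M // mulr0 add0r.
Qed.

(** A relation between x and y in L is a multiple of Y^l - h, hence holds at each point. Identities
    in L can thus be evaluated on the curve. *)
Lemma ev2_pt P a b : ev2 P = 0 -> b ^+ l = h.[a] -> pt2 a b P = 0.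
Proof.
move=> P0 ab; have [R [le_Rl PR ->//]] := ev2_reduce P.
by rewrite (ev2_indep le_Rl) ?raddf0 // -PR.
Qed.

(** In a reduced representative the coefficient of y^i gets multiplied by zeta^i, which differs from
    1 for 0 < i < l. *)
Lemma zeta_invariant P : zetaL (ev2 P) = ev2 P -> exists r, ev2 P = ev1 r.
Proof.
have [R [le_Rl -> _]] := ev2_reduce P => zR.
suff -> : R = (R`_0)%:P by exists R`_0; rewrite ev2C.
have dR : ev2 (twist 1 R - R) = 0.
  by rewrite ev2B -(iter_zeta_ev2 1) /= zR subrr.
have {}dR : twist 1 R - R = 0.
  apply: ev2_indep dR; apply: leq_trans (size_polyD _ _) _.
  by rewrite size_polyN geq_max le_Rl (leq_trans (size_poly _ _)).
apply/polyP => i; rewrite coefC; case: eqP => [->//|/eqP i_neq0].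
have [lt_il|le_li] := ltnP i l;
  last by rewrite nth_default // (leq_trans le_Rl).
move/(congr1 (fun p : {poly {poly K}} => p`_i)): dR.
rewrite coefB coef_twist muln1 coef0 -{2}[R`_i]mul1r -mulrBl => /eqP.
rewrite mulf_eq0 -polyC1 -polyCB polyC_eq0 subr_eq0 => /orP[|/eqP//].
rewrite -(expr0 zeta) (eq_prim_root_expr (kummer_root model)).
by rewrite mod0n modn_small // (negPf i_neq0).
Qed.

Definition Knorm g := \prod_(k < l) iter k zetaL g.

Lemma zeta_Knorm g : zetaL (Knorm g) = Knorm g.
Proof.
rewrite /Knorm rmorph_prod /=; move: l_gt0 (zeta_ord g); case: (l) => // n _ gn.
by rewrite [LHS]big_ord_recr /= -iterS gn [RHS]big_ord_recl /= mulrC.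
Qed.

Lemma KnormM g1 g2 : Knorm (g1 * g2) = Knorm g1 * Knorm g2.
Proof. by rewrite -big_split; apply: eq_bigr => k _; rewrite iter_rmorphM. Qed.

Lemma KnormV g : Knorm g^-1 = (Knorm g)^-1.
Proof. by rewrite /Knorm -prodfV; apply: eq_bigr => k _;
  rewrite iter_rmorphV. Qed.

Lemma Knorm_eq0 g : (Knorm g == 0) = (g == 0).
Proof.
apply/prodf_eq0/eqP => [[k _]|->]; first by rewrite iter_fmorph_eq0 => /eqP.
by exists (Ordinal l_gt0).
Qed.

Lemma KnormC a : Knorm (j a) = j (a ^+ l).
Proof.
rewrite rmorphXn -[l in RHS]card_ord -prodr_const; apply: eq_bigr => k _.
by elim: (k : nat) => //= n ->; apply: (kummer_fixC model).
Qed.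

(** The norm is invariant, hence a polynomial in x; the product of the other conjugates is the
    cofactor. So each nonzero polynomial in x and y divides a nonzero polynomial in x. *)
Lemma Knorm_ev2 P : ev2 P != 0 ->
  exists Q r, [/\ r != 0, Knorm (ev2 P) = ev1 r & ev2 P * ev2 Q = ev1 r].
Proof.
move=> P0; have Ne : Knorm (ev2 P) = ev2 (\prod_(k < l) twist k P).
  by rewrite rmorph_prod; apply: eq_bigr => k _; rewrite iter_zeta_ev2.
have [r Nr] : exists r, Knorm (ev2 P) = ev1 r.
  by rewrite Ne; apply: zeta_invariant; rewrite -Ne zeta_Knorm.
have r0 : r != 0 by rewrite -ev1_eq0 -Nr Knorm_eq0.
exists (\prod_(k < l.-1) twist k.+1 P), r; split=> //.
rewrite -Nr /Knorm; case: (l) l_gt0 => // n _ /=.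
rewrite big_ord_recl rmorph_prod; congr (_ * _); apply: eq_bigr => k _.
exact/esym/iter_zeta_ev2.
Qed.

Lemma Knorm_rat g : g != 0 ->
  exists r s, [/\ r != 0, s != 0 & Knorm g = ev1 r / ev1 s].
Proof.
have [P [Q [Q0 ->]]] := kummer_gen model g => PQ0.
have P0 : ev2 P != 0 by apply: contraNneq PQ0 => ->; rewrite mul0r.
have [_ [r [r0 Pr _]]] := Knorm_ev2 P0; have [_ [s [s0 Qs _]]] := Knorm_ev2 Q0.
by exists r, s; rewrite KnormM KnormV Pr Qs.
Qed.

(** The Lagrange resolvent u(w), the sum of g zeta(g) ... zeta^(k-1)(g) zeta^k(w) over k < l,
    satisfies u = g zeta(u); it remains to choose w with u(w) nonzero. *)
Lemma hilbert90 g : Knorm g = 1 -> exists2 u, u != 0 & u = g * zetaL u.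
Proof.
move=> Ng; pose c k := \prod_(i < k) iter i zetaL g.
pose u w := \sum_(k < l) c k * iter k zetaL w.
have [i ui] : exists i : 'I_l, u (y ^+ i) != 0.
  apply: contrapT => /forallNP u0.
  (* Averaging over the powers of y leaves only the term k = 0, by orthogonality of the powers of
     zeta; the sum l is nonzero, so some u(y^i) is. *)
  have : \sum_(i < l) u (y ^+ i) / y ^+ i = l%:R.
    rewrite /u; under eq_bigr do rewrite mulr_suml.
    rewrite exchange_big /= (bigD1 (Ordinal l_gt0)) //= /c big_ord0.
    rewrite (eq_bigr (fun=> 1)) => [|i _]; last first.
      by rewrite mul1r mulfV // expf_neq0 ?(kummer_neq0 model).
    rewrite sumr_const card_ord big1 ?addr0 // => k k0.
    rewrite (eq_bigr (fun i : 'I_l =>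
      \prod_(i < k) iter i zetaL g * j (zeta ^+ k ^+ i))).
      rewrite -mulr_sumr -rmorph_sum sum_expr_unity.
        rewrite -(expr0 zeta) (eq_prim_root_expr (kummer_root model)).
        rewrite mod0n modn_small // (_ :
          (k == 0 :> nat) = false) ?rmorph0 ?mulr0 //.
        exact/negbTE.
      by rewrite -exprM mulnC exprM zeta_l expr1n.
    move=> i _; rewrite iter_zetaYX mulrA mulfK ?expf_neq0 ?(kummer_neq0 model)
      //.
    by rewrite mulnC exprM.
  rewrite big1 => [/esym/eqP|i _]; first by rewrite (negPf lL_neq0).
  by have /negP/negPn/eqP -> := u0 i; rewrite mul0r.
exists (u (y ^+ i)) => //.
have cS k : c k.+1 = g * zetaL (c k) by rewrite /c big_ord_recl rmorph_prod.
have -> : g * zetaL (u (y ^+ i)) =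
  \sum_(k < l) c k.+1 * iter k.+1 zetaL (y ^+ i).
  rewrite /u rmorph_sum mulr_sumr; apply: eq_bigr => k _.
  by rewrite rmorphM /= cS mulrA.
(* The shifted sum closes up because c l is the norm of g, which is 1 = c 0. *)
have cl : c l * iter l zetaL (y ^+ i) = c 0 * iter 0 zetaL (y ^+ i).
  by rewrite zeta_ord -[c l]/(Knorm g) Ng /c big_ord0.
rewrite /u; move: (y ^+ i) cl => w; move: l_gt0; case: (l) => // n _ cl.
by rewrite big_ord_recl [RHS]big_ord_recr [RHS]addrC cl.
Qed.

End Kummer.

(** * Discrete valuation rings at the smooth affine points *)

Section LocalRing.

Variables (K L : fieldType) (j : {rmorphism K -> L}) (l : nat).
Variables (h : {poly K}) (x y : L) (zeta : K) (zetaL : {rmorphism L -> L}).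
Hypothesis model : kummer j l h x y zeta zetaL.

Local Notation ev1 := (ev1 j x).
Local Notation ev2 := (ev2 j x y).

Definition centered (P : place j) a b := vanish P (x - j a) && vanish P (y - j
  b).

Lemma centered_ev2 P a b : centered P a b ->
  forall G, vanish P (ev2 G - j (pt2 a b G)).
Proof.
case/andP=> Px Py.
have vM g c g' c' : vanish P (g - j c) -> vanish P (g' - j c') ->
    vanish P (g * g' - j (c * c')).
  move=> Pg Pg'.
  have -> : g * g' - j (c * c') = (g - j c) * g' + (g' - j c') * j c.
    by rewrite rmorphM; ring.
  apply: vanishD; apply: vanishM; rewrite ?ordC //.
  by rewrite -[g'](subrK (j c')); apply: ordD_ge0; rewrite ?ordC // vanish_ge0.
have vD g c g' c' : vanish P (g - j c) -> vanish P (g' - j c') ->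
    vanish P (g + g' - j (c + c')).
  by move=> Pg Pg'; rewrite rmorphD opprD addrACA; apply: vanishD.
have v1 p : vanish P (ev1 p - j p.[a]).
  elim/poly_ind: p => [|p c IH]; first by rewrite horner0 !raddf0 addr0 vanish0.
  rewrite hornerMXaddC rmorphD rmorphM /= ev1X ev1C.
  by apply: vD; [apply: vM | rewrite subrr vanish0].
elim/poly_ind => [|p c IH]; first by rewrite !raddf0 addr0 vanish0.
rewrite !(ev2D, ev2M, ev2X, ev2C) pt1E.
by apply: vD => //; apply: vM.
Qed.

Lemma centered_unit P a b : centered P a b ->
  forall G, pt2 a b G != 0 -> ord P (ev2 G) = 0.
Proof.
move=> Pab G G0; have vG := centered_ev2 Pab G.
have G_ge0 : 0 <= ord P (ev2 G).
  by rewrite -[ev2 G](subrK (j (pt2 a b G))); apply: ordD_ge0;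
    rewrite ?ordC // vanish_ge0.
apply/eqP; rewrite eq_le G_ge0 andbT leNgt; apply: contra G0 => G_gt0.
rewrite -(vanishC P) -[j _](subKr (ev2 G)) addrC; apply: vanishD;
  first by rewrite vanishN.
by rewrite /vanish G_gt0 orbT.
Qed.

(* A local parameter at the point (a, b), in a form that needs no fractions:  *)
(* E is a denominator clearing the multiples of T.                            *)
Record local_param (a b : K) (T E : {poly {poly K}}) (e : nat) :
  Prop := LocalParam {
  param_on : b ^+ l = h.[a];
  param_pt : pt2 a b T = 0;
  param_neq0 : ev2 T != 0;
  param_den : pt2 a b E != 0;
  param_X : exists A, (x - j a) * ev2 E = ev2 T * ev2 A;
  param_Y : exists A, (y - j b) * ev2 E = ev2 T * ev2 A;
  param_ord : exists U W, [/\ pt2 a b U != 0, pt2 a b W != 0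
                            & (x - j a) * ev2 U = ev2 T ^+ e * ev2 W] }.

Section Point.

Variables (a b : K) (T E : {poly {poly K}}) (e : nat).
Hypothesis param : local_param a b T E e.

Let pt_neq0 U : pt2 a b U != 0 -> ev2 U != 0.
Proof.
by apply: contraNneq => U0; rewrite (ev2_pt model U0 (param_on param)).
Qed.

(** This says g = T^n W / U with W and U nonzero at the point, that is, g is T^n times a unit of the
    local ring. *)
Definition has_ord g (n : int) := exists U W,
  [/\ pt2 a b U != 0, pt2 a b W != 0 & g * ev2 U = ev2 T ^ n * ev2 W].

Lemma has_ord_neq0 g n : has_ord g n -> g != 0.
Proof.
case=> U [W [U0 W0 gUW]]; apply: contraTneq (mulf_neq0 (expfz_neq0 n
  (param_neq0 param)) (pt_neq0 W0)).
by move=> g0; rewrite -gUW g0 mul0r eqxx.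
Qed.

Lemma has_ord_unit U : pt2 a b U != 0 -> has_ord (ev2 U) 0.
Proof.
move=> U0; exists 1, U; rewrite U0 !rmorph1 oner_eq0 mulr1 expr0z mul1r.
by split.
Qed.

Lemma has_ordM g1 n1 g2 n2 :
  has_ord g1 n1 -> has_ord g2 n2 -> has_ord (g1 * g2) (n1 + n2).
Proof.
move=> [U1 [W1 [U10 W10 g1E]]] [U2 [W2 [U20 W20 g2E]]].
exists (U1 * U2), (W1 * W2); rewrite !ev2M !mulf_neq0 //; split=> //.
rewrite expfzDr ?(param_neq0 param) // mulrACA g1E g2E; ring.
Qed.

Lemma has_ordV g n : has_ord g n -> has_ord g^-1 (- n).
Proof.
move=> gn; have g0 := has_ord_neq0 gn; case: gn => U [W [U0 W0 gE]].
have W_eq : ev2 W = ev2 T ^ (- n) * (g * ev2 U).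
  by rewrite gE mulrA -expfzDr ?(param_neq0 param) // addNr expr0z mul1r.
by exists W, U; split=> //; rewrite W_eq mulrCA mulKf.
Qed.

(** Two different exponents would equate a product nonzero at the point with a multiple of T;
    evaluation there is a contradiction. *)
Lemma has_ord_uniq g n m : has_ord g n -> has_ord g m -> n = m.
Proof.
have key (k k' : int) : has_ord g k -> has_ord g k' -> k' <= k.
  move=> gk gk'; rewrite leNgt; apply/negP => lt_k.
  have g0 := has_ord_neq0 gk.
  case: gk => U [W [U0 W0 gE]]; case: gk' => U' [W' [U0' W0' gE']].
  have [i k'_eq] : exists i : nat, k' = k + i.+1%:Z.
    by exists `|k' - k|.-1%N; lia.
  have : ev2 W * ev2 U' = ev2 T ^+ i.+1 * ev2 W' * ev2 U.
    apply: (mulfI (expfz_neq0 k (param_neq0 param))).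
    rewrite mulrA -gE mulrAC gE' k'_eq expfzDr ?(param_neq0 param) //.
    by rewrite -exprnP; ring.
  move/eqP; rewrite -subr_eq0 -ev2Xn -!ev2M -ev2B => /eqP.
  move/(ev2_pt model)/(_ (param_on param))/eqP.
  rewrite ev2B !ev2M ev2Xn (param_pt param) expr0n /= !mul0r subr0 mulf_eq0.
  by rewrite (negPf W0) (negPf U0').
by move=> gn gm; apply/eqP; rewrite eq_le !key.
Qed.

Lemma has_ordXn g n k : has_ord g n -> has_ord (g ^+ k) (n *+ k).
Proof.
move=> gn; elim: k => [|k IH].
  by rewrite expr0 -(rmorph1 ev2); apply: has_ord_unit;
    rewrite rmorph1 oner_neq0.
by rewrite exprS mulrS; apply: has_ordM.
Qed.

Lemma has_ord_XsubC : has_ord (x - j a) e.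
Proof. by case: (param_ord param) => U [W [U0 W0 E0]]; exists U, W. Qed.

Lemma has_ord_param : has_ord (ev2 T) 1.
Proof.
by exists 1, 1; rewrite !rmorph1 oner_neq0 expr1z.
Qed.

Lemma has_ord_ev1 r : r != 0 -> exists m : nat, has_ord (ev1 r) m.
Proof.
move=> r0; have [m [s sa ->]] := multiplicity_XsubC r a.
rewrite r0 /= in sa.
exists (e * m)%N.
have -> : (e * m)%N%:Z = 0 + e%:Z *+ m by rewrite add0r -mulr_natr natz PoszM.
rewrite rmorphM rmorphXn /= ev1_XsubC.
apply: has_ordM; first by rewrite -(ev2C _ _ y); apply: has_ord_unit;
  rewrite ev2C pt1E.
by apply: has_ordXn; apply: has_ord_XsubC.
Qed.

(** A polynomial vanishing at (a, b) lies in the ideal of x - a and y - b, and [E] makes both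
    divisible by T. *)
Lemma param_div G : pt2 a b G = 0 -> exists G', ev2 G * ev2 E = ev2 T * ev2 G'.
Proof.
move=> G0; have /factor_theorem[G2 G_eq] : root (G - (G.[b%:P])%:P) b%:P.
  by rewrite /root hornerD hornerN hornerC subrr.
have /factor_theorem[g1 g1_eq] : root G.[b%:P] a.
  apply/eqP; rewrite -[RHS]G0 -[G in RHS](subrK (G.[b%:P])%:P) G_eq ev2D ev2M.
  by rewrite ev2B ev2X !ev2C !pt1E hornerC subrr mulr0 add0r.
have [A1 A1E] := param_X param; have [A2 A2E] := param_Y param.
exists (g1%:P * A1 + G2 * A2).
rewrite -[G](subrK (G.[b%:P])%:P) G_eq g1_eq ev2D ev2M ev2B ev2X !ev2C ev1C.
rewrite rmorphM /= ev1_XsubC ev2D !ev2M ev2C.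
have -> : (ev2 G2 * (y - j b) + ev1 g1 * (x - j a)) * ev2 E =
  ev2 G2 * ((y - j b) * ev2 E) + ev1 g1 * ((x - j a) * ev2 E) by ring.
by rewrite A1E A2E; ring.
Qed.

(** Divide by T as long as the quotient vanishes at the point. The process stops because G divides
    some r(x), whose finite order m bounds the number of divisions. *)
Lemma has_ord_ev2 G : ev2 G != 0 -> exists n : nat, has_ord (ev2 G) n.
Proof.
move=> G0; have [Gc [r [r0 _ GGc]]] := Knorm_ev2 model G0.
have [m [U [W [U0 W0 rE]]]] := has_ord_ev1 r0.
have step n : (exists n : nat, has_ord (ev2 G) n) \/
    exists G', ev2 G * ev2 E ^+ n = ev2 T ^+ n * ev2 G'.
  elim: n => [|n [?|[G' GE]]]; [by right; exists G;
    rewrite !expr0 mul1r mulr1 | by left |].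
  have [G'0|G'0] := eqVneq (pt2 a b G') 0; last first.
    left; exists n, (E ^+ n), G'; split;
      rewrite // ev2Xn ?expf_neq0 ?(param_den param) //.
  right; have [G'' G'E] := param_div G'0; exists G''.
  by rewrite !exprSr !mulrA GE -[LHS]mulrA G'E; ring.
case: (step m.+1) => // -[G' GE].
have : ev2 W * ev2 E ^+ m.+1 = ev2 T * ev2 G' * ev2 Gc * ev2 U.
  apply: (mulfI (expf_neq0 m (param_neq0 param))).
  rewrite mulrA -[ev2 T ^+ m]/(ev2 T ^ m) -rE -GGc.
  have -> : ev2 G * ev2 Gc * ev2 U * ev2 E ^+ m.+1 =
    ev2 G * ev2 E ^+ m.+1 * ev2 Gc * ev2 U by ring.
  by rewrite GE exprS -exprnP; ring.
move/eqP; rewrite -subr_eq0 -ev2Xn -!ev2M -ev2B => /eqP.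
move/(ev2_pt model)/(_ (param_on param))/eqP.
rewrite ev2B !ev2M ev2Xn (param_pt param) !mul0r subr0 mulf_eq0.
by rewrite (negPf W0) (negPf (expf_neq0 _ (param_den param))).
Qed.

Lemma has_ord_ex g : g != 0 -> exists n, has_ord g n.
Proof.
have [P [Q [Q0 ->]]] := kummer_gen model g => PQ0.
have P0 : ev2 P != 0 by apply: contraNneq PQ0 => ->; rewrite mul0r.
have [n Pn] := has_ord_ev2 P0; have [m Qm] := has_ord_ev2 Q0.
by exists (n%:Z - m%:Z); apply: has_ordM => //; apply: has_ordV.
Qed.

Lemma has_ordD g1 n1 g2 n2 : has_ord g1 n1 -> has_ord g2 n2 -> g1 + g2 != 0 ->
  n1 <= n2 -> exists2 n, has_ord (g1 + g2) n & n1 <= n.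
Proof.
move=> [U1 [W1 [U10 W10 g1E]]] [U2 [W2 [U20 W20 g2E]]] g12 le_n.
have [i n2_eq] : exists i : nat, n2 = n1 + i%:Z by exists `|n2 - n1|%N; lia.
pose V := W1 * U2 + T ^+ i * W2 * U1.
have Tn0 := expfz_neq0 n1 (param_neq0 param).
have gV : (g1 + g2) * (ev2 U1 * ev2 U2) = ev2 T ^ n1 * ev2 V.
  have -> : (g1 + g2) * (ev2 U1 * ev2 U2) =
    (g1 * ev2 U1) * ev2 U2 + (g2 * ev2 U2) * ev2 U1 by ring.
  rewrite g1E g2E n2_eq expfzDr ?(param_neq0 param) // /V ev2D !ev2M ev2Xn.
  by rewrite -[_ ^ Posz i]exprnP; ring.
have V0 : ev2 V != 0.
  apply: contraNneq g12 => V0; move/eqP: gV; rewrite V0 mulr0 mulf_eq0.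
  by rewrite (negPf (mulf_neq0 (pt_neq0 U10) (pt_neq0 U20))) orbF.
have [k [U [W [U0 W0 VE]]]] := has_ord_ev2 V0.
exists (n1 + k%:Z); last by rewrite lerDl.
exists (U1 * U2 * U), W; rewrite !ev2M !mulf_neq0 //; split=> //.
rewrite !mulrA -[X in X * _]mulrA gV -mulrA VE expfzDr ?(param_neq0 param) //.
by rewrite mulrA.
Qed.

Lemma local_place : exists P : place j,
  [/\ centered P a b, ord P (ev2 T) = 1 & ord P (x - j a) = e].
Proof.
pose v g : int := if g == 0 then 0 else xget 0 [set n | has_ord g n]%classic.
have vE g n : has_ord g n -> v g = n.
  move=> gn; rewrite /v (negPf (has_ord_neq0 gn)).
  exact: has_ord_uniq (xgetPex 0 (ex_intro _ n gn)) gn.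
have vP : is_place j v.
  split=> [|c c0|g1 g2 g10 g20|g1 g2 g10 g20 g120|].
  - by rewrite /v eqxx.
  - apply: vE; rewrite -(ev1C j x) -(ev2C _ _ y); apply: has_ord_unit.
    by rewrite ev2C ev1C.
  - have [n1 gn1] := has_ord_ex g10; have [n2 gn2] := has_ord_ex g20.
    by rewrite (vE _ _ (has_ordM gn1 gn2)) (vE _ _ gn1) (vE _ _ gn2).
  - have [n1 gn1] := has_ord_ex g10; have [n2 gn2] := has_ord_ex g20.
    rewrite (vE _ _ gn1) (vE _ _ gn2); case: (leP n1 n2) => [le12|/ltW le21].
      by have [n gn le_n] := has_ordD gn1 gn2 g120 le12; rewrite (vE _ _ gn).
    rewrite addrC in g120 *.
    by have [n gn le_n] := has_ordD gn2 gn1 g120 le21; rewrite (vE _ _ gn).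
  - by exists (ev2 T); [apply: (param_neq0 param) | apply: vE has_ord_param].
have van g G : g = ev2 G -> pt2 a b G = 0 -> vanish (mk_place vP) g.
  move=> -> G0; rewrite /vanish; case: eqVneq => //= evG0.
  have [n Gn] := has_ord_ev2 evG0.
  rewrite -[ord _ _]/(v _) (vE _ _ Gn); case: n Gn => // Gn.
  case: Gn => U [W [U0 W0]]; rewrite expr0z mul1r => /eqP.
  rewrite -subr_eq0 -ev2M -ev2B => /eqP/(ev2_pt model)/(_ (param_on param))/eqP.
  by rewrite ev2B ev2M G0 mul0r sub0r oppr_eq0 (negPf W0).
exists (mk_place vP); split.
- apply/andP; split.
    apply: (van _ (('X - a%:P)%:P)); first by rewrite ev2C ev1_XsubC.
    by rewrite ev2C pt1E hornerXsubC subrr.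
  apply: (van _ ('X - (b%:P)%:P)); first by rewrite ev2B ev2X ev2C ev1C.
  by rewrite ev2B ev2X ev2C ev1C subrr.
- exact: vE has_ord_param.
- exact: vE has_ord_XsubC.
Qed.

(** Units have order 0 at any place centered at the point, so its valuation is a multiple of the
    exponent in [has_ord]; normalisation makes the factor 1. *)
Lemma centered_uniq P Q : centered P a b -> centered Q a b -> P = Q.
Proof.
have ordE P' : centered P' a b -> forall g n, has_ord g n -> ord P' g = n.
  move=> P'ab.
  have mulE g n : has_ord g n -> ord P' g = ord P' (ev2 T) *~ n.
    case=> U [W [U0 W0 gE]]; have gn0 : g != 0.
      by apply: (@has_ord_neq0 g n); exists U, W.
    have := congr1 (ord P') gE.
    rewrite !ordM ?pt_neq0 ?expfz_neq0 ?(param_neq0 param) // ord_expz.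
    by rewrite (centered_unit P'ab U0) (centered_unit P'ab W0) !addr0.
  have PT_ge0 : 0 <= ord P' (ev2 T).
    by have := vanish_ge0 (centered_ev2 P'ab T);
      rewrite (param_pt param) rmorph0 subr0.
  have PT : ord P' (ev2 T) = 1.
    have [t t0 Pt] := uniformizer P'; have [n tn] := has_ord_ex t0.
    have := mulE t n tn; rewrite Pt -mulrzr intz => /esym/eqP.
    case: (ord P' (ev2 T)) PT_ge0 => // m _; case: (n) => i.
      by rewrite -PoszM => /eqP[] /eqP; rewrite muln_eq1 => /andP[/eqP->].
    by rewrite NegzE mulrN -PoszM; case: (m * i.+1)%N.
  by move=> g n /mulE ->; rewrite PT -mulrzr intz mul1r.
move=> Pab Qab; apply: place_ext => g; have [->|g0] := eqVneq g 0.
  by rewrite !ord_zero.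
by have [n gn] := has_ord_ex g0;
  rewrite (ordE P Pab _ _ gn) (ordE Q Qab _ _ gn).
Qed.

End Point.

(** Here x - a is a parameter. [E] is (y^l - b^l) / (y - b), with value l b^(l-1) at the point, and
    (y - b) E = h(x) - h(a) is a multiple of x - a. *)
Lemma param_unramified a b : b != 0 -> b ^+ l = h.[a] ->
  local_param a b ('X - a%:P)%:P (\sum_(i < l) 'X ^+ (l.-1 - i) * (b%:P)%:P ^+
    i) 1.
Proof.
move=> b0 ab; set E := \sum_(i < l) _.
have YE : ('X - (b%:P)%:P) * E =
  'X^l - ((b ^+ l)%:P)%:P by rewrite -subrXX !rmorphXn.
have /factor_theorem[h1 h1E] : root (h - (b ^+ l)%:P) a.
  by rewrite /root hornerD hornerN hornerC ab subrr.
split=> //.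
- by rewrite ev2C pt1E hornerXsubC subrr.
- by rewrite ev2C (ev1_eq0 model) polyXsubC_eq0.
- rewrite /E raddf_sum /= (eq_bigr (fun=> b ^+ l.-1)) => [|i _].
    rewrite sumr_const card_ord -mulr_natl mulf_neq0 ?expf_neq0 //.
    exact: kummer_char model.
  rewrite ev2M !ev2Xn ev2X !ev2C ev1C -exprD subnK //.
  by case: i => i /=; case: l (prim_order_gt0 (kummer_root model)).
- by exists E; rewrite ev2C ev1_XsubC.
- exists h1%:P; have := congr1 ev2 YE.
  rewrite ev2M !ev2B ev2Xn ev2X !ev2C !ev1C => ->.
  rewrite (kummer_eq model) -(ev1C j x) -rmorphB h1E rmorphM /= mulrC.
  by rewrite ev1_XsubC.
exists 1, 1; rewrite !rmorph1 oner_neq0 !mulr1 expr1; split=> //.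
by rewrite ev2C ev1_XsubC.
Qed.

(** Above a simple root, y^l = (x - a) h1(x) with h1(a) nonzero: y is a parameter and x - a has
    order l. *)
Lemma param_ramified a : root h a -> (h^`()).[a] != 0 -> exists h1,
  [/\ h = h1 * ('X - a%:P), h1.[a] != 0 & local_param a 0 'X h1%:P l].
Proof.
move=> /factor_theorem[h1 h_eq]; rewrite {1}h_eq derivM derivXsubC mulr1.
rewrite hornerD hornerM hornerXsubC subrr mulr0 add0r => h1a.
have l_gt0 := prim_order_gt0 (kummer_root model).
have y_l : (x - j a) * ev1 h1 = y ^+ l.
  by rewrite (kummer_eq model) h_eq rmorphM /= ev1_XsubC mulrC.
exists h1; split=> //; split.
- by rewrite h_eq hornerM hornerXsubC subrr mulr0 expr0n eqn0Ngt l_gt0.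
- by rewrite ev2X.
- by rewrite ev2X (kummer_neq0 model).
- by rewrite ev2C pt1E.
- exists ('X ^+ l.-1); rewrite ev2C ev2Xn !ev2X y_l -exprS prednK //.
- by exists h1%:P; rewrite rmorph0 subr0 ev2X.
exists h1%:P, 1; rewrite !ev2C pt1E ev2X !rmorph1 mulr1 oner_neq0.
by split.
Qed.

End LocalRing.

(** * Every place with x integral lies over an affine point *)

Section Classification.

Variables (K : closedFieldType) (L : fieldType) (j : {rmorphism K -> L}) (l :
  nat).
Variables (h : {poly K}) (x y : L) (zeta : K) (zetaL : {rmorphism L -> L}).
Hypothesis model : kummer j l h x y zeta zetaL.

Let l_gt0 : (0 < l)%N := prim_order_gt0 (kummer_root model).

Lemma vanish_ev1 (P : place j) z p : p != 0 -> vanish P (ev1 j z p) ->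
  exists2 c, root p c & vanish P (z - j c).
Proof.
move=> p0; have [r p_eq] := closed_field_poly_normal p.
have lc0 : lead_coef p != 0 by rewrite lead_coef_eq0.
have r_root c : List.In c r -> root p c.
  move=> cr; rewrite p_eq rootZ // root_prod_XsubC.
  by elim: r cr {p_eq} => //= c' r IH [->|/IH cr]; rewrite inE ?eqxx // cr orbT.
move=> Pp; rewrite p_eq -mul_polyC rmorphM rmorph_prod /= ev1C in Pp.
have : vanish P (\prod_(c <- r) ev1 j z ('X - c%:P)).
  rewrite -[\prod_(_ <- _) _](mulKf (x := j (lead_coef p))) ?fmorph_eq0 //.
  by rewrite mulrC; apply: vanishM; rewrite // -fmorphV ordC.
by case/vanish_prod => c cr; rewrite ev1_XsubC => Pc; exists c => //;
  apply: r_root.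
Qed.

Lemma centered_on (P : place j) a b : centered x y P a b -> b ^+ l = h.[a].
Proof.
move=> Pab; have := centered_ev2 Pab ('X^l - h%:P).
rewrite !(ev2B, ev2Xn, ev2X, ev2C) pt1E (kummer_eq model) subrr sub0r vanishN.
by rewrite vanishC subr_eq0 => /eqP.
Qed.

Lemma finite_place (P : place j) : 0 <= ord P x ->
  exists a b, centered x y P a b.
Proof.
move=> x_ge0.
have ev1_ge0 p : 0 <= ord P (ev1 j x p).
  elim/poly_ind: p => [|p c IH]; first by rewrite raddf0 ord_zero.
  rewrite rmorphD rmorphM /= ev1X ev1C.
  by apply: ordD_ge0; rewrite ?ordC //; apply: ordM_ge0.
have y_ge0 : 0 <= ord P y.
  by have := ev1_ge0 h; rewrite -(kummer_eq model) ordX pmulrn_lge0.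
have ev2_ge0 G : 0 <= ord P (ev2 j x y G).
  elim/poly_ind: G => [|G c IH]; first by rewrite raddf0 ord_zero.
  rewrite ev2D ev2M ev2X ev2C.
  by apply: ordD_ge0 => //; apply: ordM_ge0.
(* Otherwise all nonzero polynomials in x are units at P, hence by the norm all polynomials in x and
   y are, and the valuation would be trivial. *)
have [r r0 Pr] : exists2 r, r != 0 & vanish P (ev1 j x r).
  apply: contrapT => /forall2NP no_r.
  have ord_ev1 r : r != 0 -> ord P (ev1 j x r) = 0.
    move=> r0; case: (no_r r) => [/(_ r0)//|/negP]; rewrite /vanish negb_or.
    by case/andP=> _; rewrite -leNgt => r_le0; apply/eqP;
      rewrite eq_le r_le0 ev1_ge0.
  have ord_ev2 G : ev2 j x y G != 0 -> ord P (ev2 j x y G) = 0.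
    move=> G0; have [Gc [r [r0 _ GGc]]] := Knorm_ev2 model G0.
    have r_x0 : ev1 j x r != 0 by rewrite (ev1_eq0 model).
    have Gc0 : ev2 j x y Gc != 0.
      by apply: contraNneq r_x0 => Gc0; rewrite -GGc Gc0 mulr0.
    have := ord_ev1 r r0; rewrite -GGc ordM // => /eqP.
    by rewrite paddr_eq0 // => /andP[/eqP].
  have [t t0 Pt] := uniformizer P; have [G [H [H0 t_eq]]] := kummer_gen model t.
  have G0 : ev2 j x y G != 0 by apply: contraNneq t0 => G0;
    rewrite t_eq G0 mul0r.
  by move: Pt; rewrite t_eq (ordM P G0 (invr_neq0 H0)) ordV !ord_ev2.
have [a _ Pa] := vanish_ev1 r0 Pr.
have q0 : 'X^l - (h.[a])%:P != 0 :> {poly K} by rewrite -size_poly_gt0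
  size_XnsubC.
have Py : vanish P (ev1 j y ('X^l - (h.[a])%:P)).
  rewrite rmorphB rmorphXn /= ev1X ev1C (kummer_eq model) -(ev1C j x) -rmorphB
    /=.
  have /factor_theorem[h1 ->] : root (h - (h.[a])%:P) a.
    by rewrite /root hornerD hornerN hornerC subrr.
  by rewrite rmorphM mulrC /= ev1_XsubC; apply: vanishM.
have [b _ Pb] := vanish_ev1 q0 Py.
by exists a, b; rewrite /centered Pa Pb.
Qed.

Lemma place_at a b : b ^+ l = h.[a] -> (root h a -> (h^`()).[a] != 0) ->
  exists P : place j, [/\ centered x y P a b,
    ord P (x - j a) = if b == 0 then l%:Z else 1 &
    forall Q, centered x y Q a b -> Q = P].
Proof.
move=> ab h'a; case: eqVneq => [b0|b0].
  have ha : root h a by rewrite /root -ab b0 expr0n eqn0Ngt l_gt0.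
  have [h1 [_ _ param]] := param_ramified model ha (h'a ha); rewrite b0.
  have [P [Pab _ Px]] := local_place model param; exists P; split=> // Q Qab.
  exact (centered_uniq model param Qab Pab).
have param := param_unramified model b0 ab.
have [P [Pab _ Px]] := local_place model param; exists P; split=> // Q Qab.
exact (centered_uniq model param Qab Pab).
Qed.

End Classification.

(** * The place at infinity *)

Section Infinity.

Variables (K : closedFieldType) (L : fieldType) (j : {rmorphism K -> L}) (l :
  nat).
Variables (h : {poly K}) (x y : L) (zeta : K) (zetaL : {rmorphism L -> L}).
Hypothesis model : kummer j l h x y zeta zetaL.
Hypothesis co_dl : coprime (size h).-1 l.

Let l_gt0 : (0 < l)%N := prim_order_gt0 (kummer_root model).

(* A chart at infinity: z = 1 / x and a monomial t in x and y with a simple   *)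
(* zero at infinity generate L, and t ^ l = z u(z) with u(0) <> 0.            *)
Lemma infinity_model : exists u t c, [/\ u.[0] != 0,
  kummer j l ('X * u) x^-1 t c zetaL & forall P :
    place j, ord P x < 0 -> vanish P t].
Proof.
have [d d_eq co_d] : exists2 d, d =
  (size h).-1 & coprime d l by exists (size h).-1.
have x0 : x != 0.
  apply/eqP => x0; apply: (kummer_trans model); rewrite x0.
  by exists 'X; rewrite ?polyX_eq0 // map_polyX rootX.
have y0 := kummer_neq0 model.
have h0 : h != 0.
  apply: contraNneq y0 => h0; have := kummer_eq model.
  by rewrite h0 raddf0 => /eqP; rewrite expf_eq0 l_gt0.
have size_h : size h = d.+1 by rewrite d_eq prednK // lt0n size_poly_eq0.
(* Bezout: al l = be d + 1. Then t = z^al y^be has t^l = z (z^d h)^be, and conversely y = (z^d h)^al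
   / t^d. *)
have [al be al_be _] := egcdnP d l_gt0.
rewrite gcdnC (eqP co_d) in al_be.
set z := x^-1; have z0 : z != 0 by rewrite invr_eq0.
(* The reversed polynomial z^d h(1/z); its constant term is the leading coefficient of h. *)
pose u0 := \poly_(i < d.+1) h`_(d - i).
have u0E : ev1 j z u0 = z ^+ d * ev1 j x h.
  have -> : ev1 j z u0 = \sum_(i < d.+1) j h`_(d - i) * z ^+ i.
    rewrite /ev1 (@horner_coef_wide _ d.+1) ?(leq_trans (size_poly _ _))
      ?size_poly //.
    by apply: eq_bigr => i _; rewrite coef_map coef_poly ltn_ord.
  have -> : ev1 j x h = \sum_(i < d.+1) j h`_i * x ^+ i.
    rewrite /ev1 (@horner_coef_wide _ d.+1) ?(leq_trans (size_poly _ _))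
      ?size_h //.
    by apply: eq_bigr => i _; rewrite coef_map.
  rewrite (reindex_inj rev_ord_inj) mulr_sumr; apply: eq_bigr => i _ /=.
  have le_id : (i <= d)%N by rewrite -ltnS.
  rewrite subSS subKn // mulrCA; congr (_ * _).
  have -> : z ^+ d = z ^+ (d - i) * z ^+ i by rewrite -exprD subnK.
  by rewrite -mulrA -exprMn mulVf // expr1n mulr1.
pose t := z ^+ al * y ^+ be.
have t0 : t != 0 by rewrite mulf_neq0 ?expf_neq0.
have t_l : t ^+ l = ev1 j z ('X * u0 ^+ be).
  rewrite rmorphM rmorphXn /= ev1X u0E /t exprMn -!exprM al_be addn1 exprS
    -mulrA.
  congr (_ * _); rewrite exprMn -!exprM [(be * d)%N]mulnC; congr (_ * _).
  by rewrite mulnC exprM (kummer_eq model).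
have y_eq : y = ev1 j z (u0 ^+ al) / t ^+ d.
  apply: (mulIf (expf_neq0 d t0)); rewrite divfK ?expf_neq0 //.
  rewrite rmorphXn /= u0E /t !exprMn -!exprM -(kummer_eq model) -exprM.
  by rewrite mulrCA -exprS [(l * al)%N]mulnC al_be addn1 [(al * d)%N]mulnC.
exists (u0 ^+ be), t, (zeta ^+ be); split.
- rewrite horner_exp expf_neq0 // horner_coef0 coef_poly /= subn0 d_eq.
  by rewrite -lead_coefE lead_coef_eq0.
- split=> //.
  + by move/algebraic_inv; rewrite invrK; apply: (kummer_trans model).
  + pose S g := exists P Q, ev2 j z t Q != 0 /\ g = ev2 j z t P / ev2 j z t Q.
    have S_poly P : S (ev2 j z t P).
      by exists P, 1; rewrite rmorph1 oner_neq0 divr1.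
    have SV g : S g -> S g^-1.
      case=> P [Q [Q0 ->]]; have [P0|P0] := eqVneq (ev2 j z t P) 0.
        by rewrite P0 mul0r invr0 -(rmorph0 (ev2 j z t)); apply: S_poly.
      by exists Q, P; rewrite invf_div.
    have SM g1 g2 : S g1 -> S g2 -> S (g1 * g2).
      move=> [P1 [Q1 [Q10 ->]]] [P2 [Q2 [Q20 ->]]]; exists (P1 * P2), (Q1 * Q2).
      by rewrite !ev2M mulf_neq0 // mulf_div.
    apply: (fun_field_ind model) => //.
    * by move=> c; rewrite -(ev1C j z) -(ev2C _ _ t); apply: S_poly.
    * have Sz : S z by have := S_poly ('X%:P); rewrite ev2C ev1X.
      by have := SV _ Sz; rewrite /z invrK.
    * rewrite y_eq -(ev2C _ _ t); apply: SM; first exact: S_poly.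
      by apply: SV; rewrite -(ev2X j z t) -ev2Xn; apply: S_poly.
    move=> g1 g2 [P1 [Q1 [Q10 ->]]] [P2 [Q2 [Q20 ->]]].
    exists (P1 * Q2 + P2 * Q1), (Q1 * Q2).
    by rewrite ev2D !ev2M mulf_neq0 // addf_div.
  + rewrite prim_root_exp_coprime ?(kummer_root model) //.
    rewrite /coprime -dvdn1 -(dvdn_addr (m := be * d)) ?dvdn_mulr ?dvdn_gcdl //.
    by rewrite -al_be dvdn_mull // dvdn_gcdr.
  + exact: kummer_char model.
  + exact: kummer_fixC model.
  + by rewrite fmorphV (kummer_fixX model).
  + rewrite /t rmorphM !rmorphXn /= fmorphV (kummer_fixX model) (kummer_act
    model).
    by rewrite exprMn mulrCA.
move=> P x_lt0; have z_gt0 : 0 < ord P z by rewrite ordV oppr_gt0.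
have z_ev p : 0 <= ord P (ev1 j z p).
  elim/poly_ind: p => [|p c IH]; first by rewrite raddf0 ord_zero.
  rewrite rmorphD rmorphM /= ev1X ev1C.
  by apply: ordD_ge0; rewrite ?ordC //; apply: ordM_ge0 => //; apply: ltW.
rewrite -(vanishX _ _ l_gt0) t_l rmorphM /= ev1X; apply: vanishM => //.
by rewrite /vanish z_gt0 orbT.
Qed.

(** In the chart of [infinity_model] the point z = t = 0 is ramified, so [param_ramified] gives 1/x
    order l there. *)
Lemma infinite_place : exists P : place j, ord P x = - l%:Z /\
  forall Q : place j, ord Q x < 0 -> Q = P.
Proof.
have [u [t [c [u0 model' t_inf]]]] := infinity_model.
have r0 : root ('X * u) 0 by rewrite /root hornerM hornerX mul0r.
have r1 : ('X * u)^`().[0] != 0.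
  by rewrite derivM derivX hornerD !hornerM hornerX mul0r addr0 hornerC mul1r.
have [h1 [_ _ param]] := param_ramified model' r0 r1.
have [P [Pab _ Px]] := local_place model' param; exists P; split.
  by move: Px; rewrite rmorph0 subr0 ordV => /(congr1 -%R); rewrite opprK.
move=> Q Qx; apply: (centered_uniq model' param) => //.
rewrite /centered rmorph0 !subr0 t_inf // andbT /vanish ordV oppr_gt0 Qx.
by rewrite orbT.
Qed.

End Infinity.

(** * Divisor classes of the curve *)

Lemma closed_nth_root (K : closedFieldType) n (c : K) :
  (0 < n)%N -> exists b, b ^+ n = c.
Proof.
move=> n_gt0; have : size ('X^n - c%:P) != 1 by rewrite size_XnsubC // -lt0n.
case/closed_rootP => b; rewrite /root !hornerE subr_eq0 => /eqP.
by exists b.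
Qed.

Section Curve.

Variables (K : closedFieldType) (L : fieldType) (j : {rmorphism K -> L}) (l :
  nat).
Variables (h : {poly K}) (x y : L) (zeta : K) (zetaL : {rmorphism L -> L}).
Hypothesis model : kummer j l h x y zeta zetaL.
Hypothesis co_dl : coprime (size h).-1 l.
Hypothesis h_sep : forall a, root h a -> (h^`()).[a] != 0.

Let l_gt0 : (0 < l)%N := prim_order_gt0 (kummer_root model).

Local Notation place := (place j).
Local Notation divisor := {freeg place / int}.
Local Notation J := (jacobian j).
Local Notation centered := (centered x y).
Local Notation rho := (@place_image _ _ j zetaL).

Implicit Types (P Q : place) (g : L) (D E : divisor).

Definition infty : place := sval (cid (infinite_place model co_dl)).

Lemma ord_infty_x : ord infty x = - l%:Z.
Proof. exact: (svalP (cid (infinite_place model co_dl))).1. Qed.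

Lemma infty_uniq Q : ord Q x < 0 -> Q = infty.
Proof. exact: (svalP (cid (infinite_place model co_dl))).2. Qed.

(** The place above (a, b); off the curve this is the junk value [infty]. *)
Definition pl a b : place := xget infty [set P | centered P a b]%classic.

Lemma pl_centered a b : b ^+ l = h.[a] -> centered (pl a b) a b.
Proof.
move=> ab; have [P [Pab _ _]] := place_at model ab (h_sep (a := a)).
by apply: (@xgetPex _ infty [set P | centered P a b]%classic); exists P.
Qed.

Lemma pl_uniq P a b : centered P a b -> P = pl a b.
Proof.
move=> Pab; have ab := centered_on model Pab.
have [Q [_ _ Q_uniq]] := place_at model ab (h_sep (a := a)).
by rewrite (Q_uniq _ Pab) (Q_uniq _ (pl_centered ab)).
Qed.

Lemma centered_x P a b : centered P a b -> 0 <= ord P x.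
Proof.
case/andP=> /vanish_ge0 Px _; rewrite -[x](subrK (j a)).
by apply: ordD_ge0; rewrite ?ordC.
Qed.

Lemma centered_neq_infty P a b : centered P a b -> P != infty.
Proof.
move=> /centered_x; apply: contraTneq => ->.
by rewrite ord_infty_x -ltNge oppr_lt0 ltz_nat.
Qed.

Lemma centered_eq P a b a' b' :
  centered P a b -> centered P a' b' -> a = a' /\ b = b'.
Proof.
by case/andP=> Pa Pb /andP[Pa' Pb'];
  rewrite (vanish_subC Pa Pa') (vanish_subC Pb Pb').
Qed.

Lemma place_cases P : P = infty \/ exists a b, centered P a b.
Proof.
have [x_ge0|x_lt0] := leP 0 (ord P x); last by left; apply: infty_uniq.
by right; apply: finite_place model _ x_ge0.
Qed.

Lemma ord_XsubC_centered P a b : centered P a b ->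
  ord P (x - j a) = if b == 0 then l%:Z else 1.
Proof.
move=> Pab; have ab := centered_on model Pab.
have [Q [_ Qx Q_uniq]] := place_at model ab (h_sep (a := a)).
by rewrite (Q_uniq _ Pab).
Qed.

Lemma ord_ev1_centered P a b r :
  centered P a b -> r.[a] != 0 -> ord P (ev1 j x r) = 0.
Proof.
by move=> Pab ra; rewrite -(ev2C j x y); apply: (centered_unit Pab);
  rewrite ev2C pt1E.
Qed.

Lemma ord_XsubC_neq P a b a' :
  centered P a b -> a' != a -> ord P (x - j a') = 0.
Proof.
move=> Pab neq; rewrite -ev1_XsubC; apply: (ord_ev1_centered Pab).
by rewrite hornerXsubC subr_eq0 eq_sym.
Qed.

Lemma XsubC_neq0 a : x - j a != 0.
Proof. by rewrite -ev1_XsubC (ev1_eq0 model) polyXsubC_eq0. Qed.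

Let x_neq0 : x != 0.
Proof. by have := XsubC_neq0 0; rewrite rmorph0 subr0. Qed.

Lemma ord_unit1 (P : place) g : vanish P (g - 1) -> ord P g = 0.
Proof.
move=> Pg; have g_ge0 : 0 <= ord P g.
  rewrite -[g](subrK 1); apply: ordD_ge0; first exact: vanish_ge0.
  by rewrite -(rmorph1 j) ordC.
apply/eqP; rewrite eq_le g_ge0 andbT leNgt; apply/negP => g_gt0.
have : vanish P (j 1); last by rewrite vanishC oner_eq0.
rewrite rmorph1 -[1](subKr g) addrC; apply: vanishD; first by rewrite vanishN.
by rewrite /vanish g_gt0 orbT.
Qed.

Lemma ord_infty_XsubC a : ord infty (x - j a) = - l%:Z.
Proof.
have -> : x - j a = x * (1 - j a / x) by rewrite mulrBr mulr1 mulrCA divff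
  ?mulr1.
have nz : 1 - j a / x != 0.
  by have := XsubC_neq0 a; apply: contraNneq => /eqP;
    rewrite subr_eq0 => /eqP e; rewrite -[x]mulr1 e mulrCA divff ?mulr1 ?subrr.
rewrite ordM // ord_infty_x ord_unit1 ?addr0 // addrAC subrr add0r vanishN.
rewrite mulrC; apply: vanishM; last by rewrite ordC.
by rewrite /vanish ordV ord_infty_x opprK ltz_nat l_gt0 orbT.
Qed.

Lemma rho_auto : const_auto j zetaL.
Proof. exact: zetaL_auto model. Qed.

Lemma ord_rho P g : ord (rho P) g = ord P (zetaL g).
Proof. exact: ord_place_image rho_auto P g. Qed.

Lemma ord_iter_rho k P g : ord (iter k rho P) g = ord P (iter k zetaL g).
Proof. by elim: k g => //= k IH g; rewrite ord_rho IH -iterSr. Qed.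

Lemma rho_l P : iter l rho P = P.
Proof. by apply: place_ext => g; rewrite ord_iter_rho (zeta_ord model). Qed.

Lemma rho_infty : rho infty = infty.
Proof.
apply: infty_uniq; rewrite ord_rho (kummer_fixX model) ord_infty_x.
by rewrite oppr_lt0 ltz_nat.
Qed.

Lemma rho_centered P a b : centered P a b -> centered (rho P) a (zeta * b).
Proof.
have van g : vanish (rho P) g = vanish P (zetaL g).
  by rewrite /vanish ord_rho fmorph_eq0.
case/andP=> Pa Pb; rewrite /centered !van !rmorphB /= !(kummer_fixC model).
rewrite (kummer_fixX model) (kummer_act model) Pa rmorphM -mulrBr mulrC.
by apply: vanishM; rewrite ?ordC.
Qed.

Lemma iter_rho_centered k P a b :
  centered P a b -> centered (iter k rho P) a (zeta ^+ k * b).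
Proof.
move=> Pab; elim: k => [|k IH]; first by rewrite mul1r.
by rewrite iterS exprS -mulrA; apply: rho_centered.
Qed.

(** Two nonzero y-coordinates over the same a differ by an l-th root of unity, a unique power of
    zeta. *)
Lemma centered_orbit P Q a b b' : b != 0 ->
  centered P a b -> centered Q a b' -> exists i : 'I_l, 
    forall k : 'I_l, (iter k rho P == Q) = (k == i).
Proof.
move=> b0 Pab Qab'; have ab := centered_on model Pab;
  have ab' := centered_on model Qab'.
have [i b'_eq] : {i : 'I_l | b' / b = zeta ^+ i}.
  apply: (prim_rootP (kummer_root model)).
  by rewrite expr_div_n ab' ab divff // -ab expf_neq0.
exists i => k; have Pk := iter_rho_centered k Pab.
apply/eqP/eqP => [PQ|->].
  rewrite PQ in Pk; have [_ b'k] := centered_eq Qab' Pk.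
  apply/val_inj/eqP; rewrite /= -(modn_small (ltn_ord k)) -(modn_small (ltn_ord
    i)).
  by rewrite -(eq_prim_root_expr (kummer_root model)) -b'_eq b'k mulfK.
rewrite (pl_uniq Qab') (pl_uniq (iter_rho_centered i Pab)).
by rewrite -b'_eq divfK.
Qed.

Definition orbit_div P : divisor := \sum_(k < l) << 1 *g iter k rho P >>.

Lemma coeff_orbit_div P Q :
  coeff Q (orbit_div P) = \sum_(k < l) (iter k rho P == Q)%:R.
Proof.
by rewrite raddf_sum; apply: eq_bigr => k _; rewrite /= coeffU mul1r.
Qed.

(** This computes div(x - a) as the orbit minus l times infinity. The orbit is l distinct simple
    zeros, or, when b = 0, one fixed point counted l times. *)
Lemma orbit_div_centered P a b Q : centered P a b ->
  coeff Q (orbit_div P) = ord Q (x - j a) + l%:Z *+ (Q == infty).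
Proof.
move=> Pab; rewrite coeff_orbit_div.
have zero : (forall k : 'I_l,
  iter k rho P != Q) -> \sum_(k < l) (iter k rho P == Q)%:R = 0 :> int.
  by move=> no; rewrite big1 // => k _; rewrite (negPf (no k)).
case: (place_cases Q) => [->|[a' [b' Qab']]].
  rewrite eqxx ord_infty_XsubC addNr; rewrite big1 // => k _.
  by rewrite (negPf (centered_neq_infty (iter_rho_centered k Pab))).
rewrite (negPf (centered_neq_infty Qab')) addr0.
have [a_eq|neq_a] := eqVneq a a'; last first.
  rewrite (ord_XsubC_neq Qab' neq_a) zero // => k;
    apply: contraNneq neq_a => PQ.
  by have [/eqP] := centered_eq (iter_rho_centered k Pab) (etrans (congr1 (fun
    R => centered R a' b') PQ) Qab').
rewrite -a_eq in Qab' *; rewrite (ord_XsubC_centered Qab').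
have ab := centered_on model Pab; have ab' := centered_on model Qab'.
have [b0|b0] := eqVneq b 0.
  have b'0 : b' = 0.
    by apply/eqP; have := ab'; rewrite -ab b0 expr0n eqn0Ngt l_gt0 => /eqP;
      rewrite expf_eq0 l_gt0.
  rewrite b'0 eqxx (eq_bigr (fun=> 1)) => [|k _];
    first by rewrite sumr_const card_ord natz.
  have Pk := iter_rho_centered k Pab; rewrite b0 mulr0 in Pk.
  by rewrite (pl_uniq Pk) (pl_uniq Qab') b'0 eqxx.
have b'0 : b' != 0.
  by apply: contraNneq (expf_neq0 l b0) => b'0;
    rewrite ab -ab' b'0 expr0n eqn0Ngt l_gt0.
have [i iP] := centered_orbit b0 Pab Qab'.
rewrite (negPf b'0) (bigD1 i) //= iP eqxx big1 ?addr0 // => k ki.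
by rewrite iP (negPf ki).
Qed.

Lemma coeff_supp_infty D : deg D = 0 ->
  (forall P, P != infty -> coeff P D = 0) -> D = 0.
Proof.
move=> degD D0.
have D_eq : D = << coeff infty D *g infty >>.
  apply: divisor_ext => Q; rewrite coeffU; have [<-|neq] := eqVneq infty Q.
    by rewrite mulr1.
  by rewrite mulr0 D0 // eq_sym.
by move: degD; rewrite D_eq degU => ->; rewrite freegU0.
Qed.

Definition has_div g := exists2 D :
  divisor, deg D = 0 & forall P, coeff P D = ord P g.

Lemma has_divM g1 g2 : g1 != 0 -> g2 != 0 ->
  has_div g1 -> has_div g2 -> has_div (g1 * g2).
Proof.
move=> g10 g20 [D1 d1 D1E] [D2 d2 D2E]; exists (D1 + D2).
  by rewrite degD d1 d2.
by move=> P; rewrite coeffD ordM // D1E D2E.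
Qed.

Lemma has_divV g : has_div g -> has_div g^-1.
Proof.
move=> [D d DE]; exists (- D); first by rewrite degN d oppr0.
by move=> P; rewrite coeffN ordV DE.
Qed.

Lemma has_divC a : has_div (j a).
Proof. by exists 0; rewrite ?deg0 // => P; rewrite coeff0 ordC. Qed.

Lemma deg_orbit_div P : deg (orbit_div P) = l%:Z.
Proof.
rewrite raddf_sum (eq_bigr (fun=> 1)) => [|k _]; last exact: degU.
by rewrite sumr_const card_ord natz.
Qed.

Lemma curve_point a : exists b, b ^+ l = h.[a].
Proof. exact: closed_nth_root. Qed.

Lemma has_div_XsubC a : has_div (x - j a).
Proof.
have [b ab] := curve_point a; have Pab := pl_centered ab.
exists (orbit_div (pl a b) - << l%:Z *g infty >>).
  by rewrite degB deg_orbit_div degU subrr.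
move=> Q; rewrite coeffB (orbit_div_centered _ Pab) coeffU eq_sym.
by case: eqP; rewrite ?mulr1 ?mulr0 ?mulr0n ?subr0 ?addrK.
Qed.

Lemma has_div_ev1 r : r != 0 -> has_div (ev1 j x r).
Proof.
move=> r0; have [s r_eq] := closed_field_poly_normal r.
rewrite r_eq -mul_polyC rmorphM rmorph_prod /= ev1C.
have [nz hd] : \prod_(c <- s) ev1 j x ('X - c%:P) != 0 /\
    has_div (\prod_(c <- s) ev1 j x ('X - c%:P)).
  elim: {r_eq} s => [|c s [nz hd]].
    by rewrite big_nil oner_neq0; split=> //; rewrite -(rmorph1 j);
      apply: has_divC.
  rewrite big_cons ev1_XsubC mulf_neq0 ?XsubC_neq0 //; split=> //.
  by apply: has_divM; rewrite ?XsubC_neq0 //; apply: has_div_XsubC.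
by apply: has_divM => //; [rewrite fmorph_eq0 lead_coef_eq0 | apply: has_divC].
Qed.

(** A polynomial in x and y divides some r(x), so its finite zeros lie over the finitely many roots
    of r; away from infinity it has no poles. *)
Lemma finite_support g : g != 0 -> exists D, forall P, coeff P D = ord P g.
Proof.
have poly_case G : ev2 j x y G != 0 -> exists D, forall P, coeff P D =
  ord P (ev2 j x y G).
  move=> G0; have [Gc [r [r0 _ GGc]]] := Knorm_ev2 model G0.
  have [s r_eq] := closed_field_poly_normal r.
  have /all_sig[roots rootsP] c : {t : seq K | forall b, b ^+ l = c -> b \in t}.
    apply: cid; have [t t_eq] := closed_field_poly_normal ('X^l - c%:P).
    exists t => b bc; have : root ('X^l - c%:P) b by rewrite /root !hornerE bc
      subrr.
    by rewrite t_eq lead_coefXnsubC // scale1r root_prod_XsubC.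
  pose S := undup (infty :: flatten [seq [seq pl a b | b <- roots h.[a]] | a <-
    s]).
  have ev_ge0 P a b : centered P a b -> forall H, 0 <= ord P (ev2 j x y H).
    move=> Pab H; rewrite -[ev2 _ _ _ H](subrK (j (pt2 a b H))).
    by apply: ordD_ge0; rewrite ?ordC // vanish_ge0 // centered_ev2.
  have notS P : P \notin S -> ord P (ev2 j x y G) = 0.
    rewrite mem_undup inE negb_or => /andP[/eqP PNinf PNS].
    case: (place_cases P) => // -[a [b Pab]].
    apply/eqP; rewrite eq_le (ev_ge0 _ _ _ Pab) andbT leNgt;
      apply: contra PNS => G_gt0.
    have : vanish P (ev1 j x r - j r.[a]).
      have := centered_ev2 Pab r%:P; by rewrite !ev2C pt1E.
    rewrite -GGc -vanishN opprB => vr.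
    have : vanish P (j r.[a]).
      rewrite -[j _](subrK (ev2 j x y G * ev2 j x y Gc)); apply: vanishD => //.
      by apply: vanishM; rewrite ?(ev_ge0 _ _ _ Pab) // /vanish G_gt0 orbT.
    rewrite vanishC => ra; rewrite (pl_uniq Pab).
    apply/flattenP; exists [seq pl a b | b <- roots h.[a]]; apply: map_f.
      by rewrite -root_prod_XsubC -(rootZ _ _ (a := lead_coef r))
        ?lead_coef_eq0 // -r_eq.
    by apply: rootsP; exact: (centered_on model Pab).
  exists (\sum_(P <- S) << ord P (ev2 j x y G) *g P >>) => Q.
  rewrite raddf_sum /=; have [QS|QNS] := boolP (Q \in S).
    rewrite (bigD1_seq Q) ?undup_uniq //= coeffU eqxx mulr1 big1 ?addr0 // => P.
    by rewrite coeffU => /negPf ->; rewrite mulr0.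
  rewrite notS // big_seq big1 // => P PS; rewrite coeffU.
  by case: eqP PS QNS => [-> ->|]; rewrite ?mulr0.
have [G [H [H0 ->]]] := kummer_gen model g => GH0.
have G0 : ev2 j x y G != 0 by apply: contraNneq GH0 => ->; rewrite mul0r.
have [D DE] := poly_case _ G0; have [E EE] := poly_case _ H0.
exists (D - E) => P.
by rewrite coeffB DE EE (ordM P G0 (invr_neq0 H0)) ordV.
Qed.

Lemma coeff_iter_push k D P :
  coeff (iter k rho P) (iter k (push_div zetaL) D) = coeff P D.
Proof.
by elim: k => //= k <-; exact: (coeff_push_div rho_auto).
Qed.

Lemma iter_rho_surj k Q : exists P, iter k rho P = Q.
Proof.
elim: k Q => [|k IH] Q; first by exists Q.
have [P PQ] := place_image_surj rho_auto Q; have [R RP] := IH P.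
by exists R; rewrite iterS RP.
Qed.

(** The conjugates of g have divisors of equal degree, and these add up to the divisor of the norm,
    a rational function of x, of degree 0. So l times the degree of g is 0. *)
Lemma principal_div g : g != 0 -> has_div g.
Proof.
move=> g0; have /all_sig[D DE] (k : nat) : {D :
  divisor | forall P, coeff P D = ord P (iter k zetaL g)}.
  by apply: cid; apply: finite_support; rewrite iter_fmorph_eq0.
have degDk k : deg (D k) = deg (D 0).
  have <- : iter k (push_div zetaL) (D k) = D 0.
    apply: divisor_ext => Q; have [P <-] := iter_rho_surj k Q.
    by rewrite coeff_iter_push !DE ord_iter_rho.
  by elim: k (D k) => //= k IH E; rewrite deg_push_div IH.
have [r [s [r0 s0 Ng]]] := Knorm_rat model g0.
have [E degE EE] : has_div (Knorm l zetaL g).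
  rewrite Ng; apply: has_divM; rewrite ?invr_eq0 ?(ev1_eq0 model) //.
    exact: has_div_ev1.
  by apply: has_divV; apply: has_div_ev1.
have sumD : \sum_(k < l) D k = E.
  apply: divisor_ext => P; rewrite EE raddf_sum /Knorm ord_prod => [|k _].
    by apply: eq_bigr => k _; rewrite /= DE.
  by rewrite iter_fmorph_eq0.
exists (D 0) => [|P]; last exact: DE.
move: degE; rewrite -sumD raddf_sum (eq_bigr (fun=> deg (D 0))) => [|k _];
  last exact: degDk.
rewrite sumr_const card_ord => /eqP; rewrite mulrn_eq0 eqn0Ngt l_gt0.
by move/eqP.
Qed.

(** In lowest terms, a root of the numerator would give a zero of g at a point above it, a root of
    the denominator a pole; both are therefore constant. *)
Lemma constant_of_ord g : g != 0 -> (forall P, ord P g = 0) ->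
  (exists r s, [/\ r != 0, s != 0 & g = ev1 j x r / ev1 j x s]) ->
  exists2 c, c != 0 & g = j c.
Proof.
move=> g0 g_ord [r [s [r0 s0 g_eq]]].
have [r' [s' [d [r_eq s_eq d0 co]]]] : exists r' s' d : {poly K},
    [/\ r = r' * d, s = s' * d, d != 0 & coprimep r' s'].
  exists (r %/ gcdp r s), (s %/ gcdp r s), (gcdp r s).
  by rewrite !divpK ?dvdp_gcdl ?dvdp_gcdr // gcdp_eq0 (negPf r0)
    coprimep_div_gcd ?r0.
have {}g_eq : g = ev1 j x r' / ev1 j x s'.
  rewrite g_eq r_eq s_eq !rmorphM /= -mulf_div divff ?mulr1 //.
  by rewrite (ev1_eq0 model).
have r'0 : r' != 0 by apply: contraNneq g0 => e; rewrite g_eq e raddf0 mul0r.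
have s'0 : s' != 0 by apply: contraNneq g0 => e;
  rewrite g_eq e raddf0 invr0 mulr0.
have no_root p1 p2 : p1 != 0 -> p2 != 0 -> coprimep p1 p2 ->
    (forall P, ord P (ev1 j x p1) = ord P (ev1 j x p2)) -> size p1 == 1%N.
  move=> p10 p20 cop p12; apply/negPn/negP => /closed_rootP[a p1a].
  have [b ab] := curve_point a; have Pab := pl_centered ab.
  have p2a : p2.[a] != 0 by apply: (coprimep_root cop).
  have := p12 (pl a b); rewrite (ord_ev1_centered Pab p2a).
  have /factor_theorem[p3 p3E] := p1a.
  have p30 : p3 != 0 by apply: contraNneq p10 => e; rewrite p3E e mul0r.
  rewrite p3E rmorphM /= ordM ?(ev1_eq0 model) ?polyXsubC_eq0 // ev1_XsubC =>
    /eqP.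
  rewrite gt_eqF //; apply: ltr_wpDl.
    have := centered_ev2 Pab p3%:P; rewrite !ev2C pt1E => /vanish_ge0 v0.
    by rewrite -[ev1 _ _ _](subrK (j p3.[a])); apply: ordD_ge0; rewrite ?ordC.
  by rewrite (ord_XsubC_centered Pab); case: ifP.
have ord_rs P : ord P (ev1 j x r') = ord P (ev1 j x s').
  apply/eqP; rewrite -subr_eq0 -ordV -ordM ?(ev1_eq0 model) //; last first.
    by rewrite invr_neq0 // (ev1_eq0 model).
  by rewrite -g_eq g_ord.
have /size_poly1P[c c0 rc] := no_root _ _ r'0 s'0 co ord_rs.
have co' : coprimep s' r' by rewrite coprimep_sym.
have /size_poly1P[c' c'0 sc] := no_root _ _ s'0 r'0 co' (fun P =>
  esym (ord_rs P)).
by exists (c / c'); rewrite ?mulf_neq0 ?invr_eq0 // g_eq rc sc !ev1C fmorph_div.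
Qed.

End Curve.

(** * Orbit sums and invariant classes in the Jacobian *)

Section CurveClasses.

Variables (K : closedFieldType) (L : fieldType) (j : {rmorphism K -> L}) (l :
  nat).
Variables (h : {poly K}) (x y : L) (zeta : K) (zetaL : {rmorphism L -> L}).
Hypothesis model : kummer j l h x y zeta zetaL.
Hypothesis co_dl : coprime (size h).-1 l.
Hypothesis h_sep : forall a, root h a -> (h^`()).[a] != 0.

Let l_gt0 : (0 < l)%N := prim_order_gt0 (kummer_root model).

Local Notation place := (place j).
Local Notation divisor := {freeg place / int}.
Local Notation J := (jacobian j).
Local Notation centered := (centered x y).
Local Notation rho := (@place_image _ _ j zetaL).
Local Notation infty := (infty model co_dl).
Local Notation pl := (pl model co_dl).
Implicit Types (P Q : place) (g : L) (D E : divisor).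

Lemma iter_push_divU k n P :
  iter k (push_div zetaL) << n *g P >> = << n *g iter k rho P >> :> divisor.
Proof. by elim: k => //= k ->; rewrite push_divU. Qed.

(** By linearity it suffices to treat one point: a finite one over a contributes div(x - a) plus l
    times infinity. *)
Lemma sum_push_div D : exists2 g, g != 0 & forall Q,
  coeff Q (\sum_(k < l) iter k (push_div zetaL) D)
    = ord Q g + (deg D * l%:Z) *+ (Q == infty).
Proof.
have iterD k (D1 D2 : divisor) : iter k (push_div zetaL) (D1 + D2) =
    iter k (push_div zetaL) D1 + iter k (push_div zetaL) D2.
  by elim: k => //= k ->; rewrite raddfD.
pose S D := exists2 g, g != 0 & forall Q,
  coeff Q (\sum_(k < l) iter k (push_div zetaL) D)
    = ord Q g + (deg D * l%:Z) *+ (Q == infty).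
rewrite -/(S D) -[D]freeg_sumE.
apply: (big_ind S) => [|D1 D2 [g1 g10 D1E] [g2 g20 D2E]|P _].
- exists 1; rewrite ?oner_neq0 // => Q;
  rewrite deg0 mul0r mul0rn Defs.ord1 addr0.
  rewrite big1 ?coeff0 // => k _; elim: (k : nat) => //= n ->; exact: raddf0.
- exists (g1 * g2); first by rewrite mulf_neq0.
  move=> Q; under eq_bigr do rewrite iterD.
  rewrite big_split coeffD /= D1E D2E ordM // degD mulrDl mulrnDl; ring.
move: (coeff P D) => n; rewrite /S.
have -> : \sum_(k < l) iter k (push_div zetaL) << n *g P >> =
  orbit_div l zetaL P *~ n :> divisor.
  rewrite /orbit_div mulrz_suml; apply: eq_bigr => k _.
  by rewrite iter_push_divU freeg_mulz intz.
rewrite degU.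
case: (place_cases model co_dl P) => [->|[a [b Pab]]].
  exists 1; rewrite ?oner_neq0 // => Q; rewrite Defs.ord1 add0r raddfMz /=.
  rewrite coeff_orbit_div (eq_bigr (fun=> (Q == infty)%:R)) => [|k _].
    by rewrite sumr_const card_ord -mulrzr; case: eqP => _ /=; lia.
  by have -> : iter k rho infty = infty; [elim: (k : nat) => //= i ->;
    apply: rho_infty | rewrite eq_sym].
exists ((x - j a) ^ n); first by rewrite expfz_neq0 // (XsubC_neq0 model).
move=> Q; rewrite raddfMz /= (orbit_div_centered model co_dl h_sep Q Pab)
  ord_expz.
by rewrite mulrzDl; congr (_ + _); case: eqP => _;
  rewrite ?mulr1n ?mul0rz // -mulrzr mulrC; lia.
Qed.

Lemma push_pi_zeta (D0 : div0 j) :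
  push zetaL (\pi_J D0) = \pi_J (push_div0 zetaL D0).
Proof. exact: push_pi (rho_auto model) D0. Qed.

Lemma sum_push (v : J) : \sum_(k < l) iter k (push zetaL) v = 0.
Proof.
elim/quotW: v => D.
have iter_pi k : iter k (push zetaL) (\pi_J D) =
  \pi_J (iter k (push_div0 zetaL) D).
  by elim: k => //= k ->; rewrite push_pi_zeta.
under eq_bigr do rewrite iter_pi.
rewrite -(raddf_sum \pi_J); apply/eqP; rewrite pi_eq0.
apply/principalP; have [g g0 gE] := sum_push_div (val D).
exists g => // Q; have /eqP degD : deg (val D) == 0 by exact: (valP D).
move: (gE Q); rewrite degD mul0r mul0rn addr0 => <-; congr (coeff Q _).
rewrite raddf_sum; apply: eq_bigr => k _ /=.
by elim: (k : nat) => //= n <-; rewrite val_push_div0.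
Qed.

Lemma branch_div_subproof a : (<< pl a 0 >> - << infty >> :
  divisor) \in @degree0 _ _ j.
Proof. by rewrite inE degB !degU subrr. Qed.

Definition branch_div a : div0 j :=
  exist (fun D => D \in @degree0 _ _ j) _ (branch_div_subproof a).

Lemma val_branch_div a : val (branch_div a) = << pl a 0 >> - << infty >>.
Proof. by []. Qed.

Lemma coeff_branch_div a P : P != infty ->
  coeff P (val (branch_div a)) = (pl a 0 == P)%:R.
Proof.
move=> PN; rewrite val_branch_div coeffB !coeffU !mul1r [infty == _]eq_sym
  (negPf PN).
by rewrite subr0.
Qed.

(** An invariant class contains an invariant divisor, by Hilbert 90. Such a divisor is a combination
    of branch points and of full fibres of x, and the fibres are equivalent to multiples of
    infinity. *)
Lemma ker_push (rs : seq K) (v : J) :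
  uniq rs -> (forall a, (a \in rs) = root h a) ->
  push zetaL v = v -> exists n :
    K -> int, v = \sum_(a <- rs) \pi_J (branch_div a) *~ n a.
Proof.
move=> rs_uniq rsP; elim/quotW: v => D.
rewrite push_pi_zeta => /esym/eqP; rewrite piE => /principalP[g g0 gE].
have {}gE P : coeff P (val D) - coeff (rho P) (val D) = - ord P (zetaL g).
  have := gE (rho P); rewrite [val _](raddfB (val :
    div0 j -> divisor)) coeffB /= val_push_div0.
  by rewrite (coeff_push_div (rho_auto model)) (ord_rho model) => <-;
    rewrite opprB.
pose g1 := (zetaL g)^-1; have g10 : g1 != 0 by rewrite invr_eq0 fmorph_eq0.
have {}gE P : coeff P (val D) - coeff (rho P) (val D) =
  ord P g1 by rewrite gE ordV.
(* Along an orbit the differences of coefficients of D telescope, so the norm of [g1] has neither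
   zeros nor poles. *)
have Ng1 P : ord P (Knorm l zetaL g1) = 0.
  rewrite /Knorm ord_prod => [|k _]; last by rewrite iter_fmorph_eq0.
  rewrite (eq_bigr (fun k : 'I_l =>
    - (coeff (iter k.+1 rho P) (val D) - coeff (iter k rho P) (val D)))).
    rewrite sumrN -(big_mkord xpredT (fun k =>
      coeff (iter k.+1 rho P) (val D) - coeff (iter k rho P) (val D))).
    by rewrite telescope_sumr // (rho_l model) subrr oppr0.
  by move=> k _; rewrite opprB -(ord_iter_rho model) -gE.
have N0 : Knorm l zetaL g1 != 0 by rewrite (Knorm_eq0 model).
have [c c0 Nc] := constant_of_ord model co_dl h_sep N0 Ng1 (Knorm_rat model
  g10).
(* Dividing [g1] by an l-th root of the constant c makes its norm 1, as [hilbert90] requires. *)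
have [c1 c1l] := closed_nth_root c l_gt0.
have c10 : c1 != 0 by apply: contraNneq c0 => e;
  rewrite -c1l e expr0n eqn0Ngt l_gt0.
have [u u0 uE] : exists2 u, u != 0 & u = g1 / j c1 * zetaL u.
  apply: (hilbert90 model); rewrite KnormM Nc -fmorphV (KnormC model).
  by rewrite exprVn c1l -rmorphM mulfV ?rmorph1.
have gE1 P : ord P g1 = ord P u - ord (rho P) u.
  rewrite (ord_rho model) {1}uE ordM ?fmorph_eq0 ?mulf_neq0 ?invr_neq0
    ?fmorph_eq0 //.
  by rewrite ordM ?invr_neq0 ?fmorph_eq0 // ordV ordC; ring.
have [U degU UE] := principal_div model co_dl h_sep u0.
(* [D1] = D - div(u) is invariant under [rho]. *)
pose D1 : divisor := val D - U.
have D1_rho P : coeff (rho P) D1 = coeff P D1.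
  rewrite /D1 !coeffB !UE; apply/eqP; rewrite -subr_eq0; apply/eqP.
  by have := gE P; rewrite gE1 => e; lia.
have D1_iter k P : coeff (iter k rho P) D1 = coeff P D1.
  by elim: k => //= k <-; apply: D1_rho.
(* Removing the branch points leaves [D2], which has degree 0, vanishes at them and is constant on
   the other finite fibres. *)
pose D2 : divisor := D1 - \sum_(a <- rs) val (branch_div a) *~ coeff (pl a 0)
  D1.
have deg_val (E : div0 j) : deg (val E) = 0 by apply/eqP; exact: (valP E).
have degD2 : deg D2 = 0.
  rewrite degB degB degU deg_val subrr raddf_sum big1 ?subr0 // => a _.
  by rewrite raddfMz [X in X *~ _](deg_val (branch_div a)) mul0rz.
have pl0 a : root h a -> centered (pl a 0) a 0.
  move=> /rootP ha; apply: (pl_centered model co_dl h_sep);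
    rewrite ha expr0n eqn0Ngt l_gt0 //.
have D2E P a b : centered P a b -> coeff P D2 =
  if b == 0 then 0 else coeff P D1.
  move=> Pab; have ab := centered_on model Pab.
  have PN := centered_neq_infty model co_dl Pab.
  rewrite /D2 coeffB raddf_sum /=; have [b0|b0] := eqVneq b 0; last first.
    rewrite big_seq big1 ?subr0 // => a' a'rs;
      rewrite raddfMz /= coeff_branch_div //.
    have [e|_] := eqVneq (pl a' 0) P; last by rewrite mul0rz.
    rewrite rsP in a'rs; have := pl0 _ a'rs; rewrite e => P0.
    by have [_ e0] := centered_eq Pab P0; rewrite e0 eqxx in b0.
  rewrite b0 in Pab ab; have ars : a \in rs.
    by rewrite rsP /root -ab expr0n eqn0Ngt l_gt0.
  have PE := pl_uniq model co_dl h_sep Pab.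
  rewrite (bigD1_seq a) //= raddfMz /= coeff_branch_div // -PE eqxx.
  rewrite big_seq_cond big1 => [|a' /andP[a'rs neq]].
    by rewrite addr0 -mulrzl mulr1 intz subrr.
  rewrite raddfMz /= coeff_branch_div //; have [e|_] := eqVneq (pl a' 0) P;
    last by rewrite mul0rz.
  rewrite rsP in a'rs; have := pl0 _ a'rs; rewrite e => P0.
  by have [e0 _] := centered_eq Pab P0; rewrite e0 eqxx in neq.
pose xc P := xget 0 [set a | vanish P (x - j a)]%classic.
have xcE P a b : centered P a b -> xc P = a.
  case/andP=> Pa _; apply: (vanish_subC (P := P) _ Pa).
  exact: (@xgetPex _ 0 [set a | vanish P (x - j a)]%classic (ex_intro _ a Pa)).
have /all_sig[bc bcP] a := cid (closed_nth_root h.[a] l_gt0).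
(* The value of [D2] on the fibre over a, so that [D2] is the divisor of [phi]: they agree at finite
   points, hence everywhere by their degrees. *)
pose m a := if root h a then 0 else coeff (pl a (bc a)) D1.
pose S := undup [seq xc P | P <- dom D1].
pose phi := \prod_(a <- S) (x - j a) ^ m a.
have factor0 a : (x - j a) ^ m a != 0 by rewrite expfz_neq0 // (XsubC_neq0
  model).
have phi0 : phi != 0 by rewrite prodf_seq_neq0; apply/allP => a _;
  rewrite factor0.
have [V degV VE] := principal_div model co_dl h_sep phi0.
have D2V : D2 = V.
  apply/eqP; rewrite -subr_eq0; apply/eqP.
  apply: (coeff_supp_infty (model := model) (co_dl := co_dl)).
    by rewrite degB degD2 degV subrr.
  move=> P PN; case: (place_cases model co_dl P) PN => [->|[a [b Pab] _]];
    first by rewrite eqxx.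
  have ab := centered_on model Pab.
  rewrite coeffB VE (D2E _ _ _ Pab) /phi ord_prod => [|a' _];
    last exact: factor0.
  have ord_a' a' : a' != a -> ord P ((x - j a') ^ m a') = 0.
    by move=> neq; rewrite ord_expz (ord_XsubC_neq Pab neq) mul0rz.
  have sum_eq : \sum_(a' <- S) ord P ((x - j a') ^ m a') =
      if a \in S then ord P (x - j a) *~ m a else 0.
    case: ifP => aS.
      rewrite (bigD1_seq a) ?undup_uniq //= ord_expz big1 ?addr0 //.
    rewrite big_seq big1 // => a' a'S; apply: ord_a'.
    by apply: contraTneq a'S => ->; rewrite aS.
  rewrite sum_eq (ord_XsubC_centered model h_sep Pab).
  have [b0|b0] := eqVneq b 0.
    have ha : root h a by rewrite /root -ab b0 expr0n eqn0Ngt l_gt0.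
    by rewrite /m ha mulr0z; case: ifP.
  have ha : root h a = false.
    by apply: contraNF (expf_neq0 l b0) => /rootP; rewrite ab => ->.
  have mE : m a = coeff P D1.
    rewrite /m ha; have Qab := pl_centered model co_dl h_sep (bcP a).
    have [i iP] := centered_orbit model co_dl h_sep b0 Pab Qab.
    by have /eqP <- : iter i rho P == pl a (bc a); rewrite ?iP ?eqxx ?D1_iter.
  rewrite mE; case: ifP => [_|aNS]; first by rewrite -mulrzl mulr1 intz subrr.
  rewrite subr0; apply/eqP/negPn; rewrite -mem_dom; apply/negP => PD.
  by move/negP: aNS; apply; rewrite mem_undup -(xcE _ _ _ Pab); apply: map_f.
exists (fun a => coeff (pl a 0) D1).
have -> : \sum_(a <- rs) \pi_J (branch_div a) *~ coeff (pl a 0) D1 =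
    \pi_J (\sum_(a <- rs) branch_div a *~ coeff (pl a 0) D1).
  by rewrite raddf_sum; apply: eq_bigr => a _; rewrite raddfMz.
apply/eqP; rewrite piE; apply/principalP; exists (u * phi);
  first by rewrite mulf_neq0.
have val_eq : val (D - \sum_(a <- rs) branch_div a *~ coeff (pl a 0) D1) =
    val D - \sum_(a <- rs) val (branch_div a) *~ coeff (pl a 0) D1.
  rewrite [LHS](raddfB (val : div0 j -> divisor)); congr (_ - _).
  rewrite [LHS](raddf_sum (val : div0 j -> divisor)); apply: eq_bigr => a _.
  exact: (raddfMz (val : div0 j -> divisor)).
move=> P; rewrite val_eq ordM // -UE -VE -D2V /D2 /D1 !coeffB; ring.
Qed.

End CurveClasses.

(** * Finite fields and their Frobenius maps *)

Lemma finField_pnat (F : finFieldType) :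
  exists2 p, p \in [pchar F] & p.-nat #|F|.
Proof.
have [p p_pr pF] := finPcharP F; exists p => //.
by rewrite -cardsT; apply: abelem_pgroup (fin_ring_pchar_abelem pF).
Qed.

Lemma finField_frobeniusD (F : finFieldType) (R : comNzRingType)
    (i : {rmorphism F -> R}) (a b : R) :
  (a + b) ^+ #|F| = a ^+ #|F| + b ^+ #|F|.
Proof.
apply: exprDn_pchar.
have [p pF] := finField_pnat F.
apply: sub_in_pnat => r _ /eqnP ->.
exact: rmorph_pchar pF.
Qed.

Lemma finField_frobenius (F : finFieldType) (R : comNzRingType)
    (i : {rmorphism F -> R}) :
  exists phi : {rmorphism R -> R}, forall a, phi a = a ^+ #|F|.
Proof.
have q_gt0 : (0 < #|F|)%N := ltnW (card_finNzRing_gt1 F).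
pose phi (a : R) := a ^+ #|F|.
have phiB : zmod_morphism phi.
  move=> a b; apply: (addIr (phi b)).
  by rewrite subrK -(finField_frobeniusD i) subrK.
have phiM : monoid_morphism phi by split=> [|a b]; rewrite /phi ?expr1n ?exprMn.
pose phi' : {rmorphism R -> R} := HB.pack phi
  (GRing.isZmodMorphism.Build R R phi phiB) (GRing.isMonoidMorphism.Build R R
    phi phiM).
by exists phi'.
Qed.

Section Orbit.

Variables (F : finFieldType) (K : fieldType) (io : {rmorphism F -> K}).
Local Notation q := #|F|.

Let q_gt0 : (0 < q)%N := ltnW (card_finNzRing_gt1 F).
Let q_gt1 : (1 < q)%N := card_finNzRing_gt1 F.

(** X^q - X already splits over F with the elements of F as roots. *)
Lemma fixed_by_frobenius (c : K) : c ^+ q = c -> exists d, io d = c.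
Proof.
move=> cq; have : root (map_poly io ('X^q - 'X)) c.
  by rewrite rmorphB rmorphXn /= map_polyX /root !hornerE cq subrr.
rewrite finField_genPoly rmorph_prod /= => /rootP; rewrite horner_prod => /eqP.
rewrite prodf_seq_eq0 => /hasP[d _]; rewrite /= rmorphB /= map_polyX map_polyC.
by rewrite hornerXsubC subr_eq0 => /eqP ->; exists d.
Qed.

Lemma frobenius_inj n : injective (fun a : K => a ^+ (q ^ n)).
Proof.
elim: n => [|n IH] a b /=; first by rewrite !expr1.
have [phi phiE] := finField_frobenius io.
by rewrite expnSr !exprM -!phiE => /fmorph_inj; apply: IH.
Qed.

Definition frob_orbit (a : K) m := [seq a ^+ (q ^ i) | i <- seq.iota 0 m].

Lemma root_frob_orbit p a i :
  root (map_poly io p) a -> root (map_poly io p) (a ^+ (q ^ i)).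
Proof.
move=> pa; have [phi phiE] := finField_frobenius io.
elim: i => [|i IH]; first by rewrite expr1.
rewrite expnSr exprM -phiE;
  have <- : map_poly phi (map_poly io p) = map_poly io p.
  by apply/polyP => k; rewrite !coef_map /= phiE -rmorphXn expf_card.
by rewrite fmorph_root.
Qed.

Lemma frob_iterD (a : K) m n : a ^+ (q ^ (m + n)) = (a ^+ (q ^ m)) ^+ (q ^ n).
Proof. by rewrite expnD exprM. Qed.

Lemma frob_period_mul (a : K) m n : a ^+ (q ^ m) = a -> a ^+ (q ^ (m * n)) = a.
Proof.
by move=> am; elim: n => [|n IH]; rewrite ?muln0 ?expr1 // mulnS frob_iterD am.
Qed.

(** The conjugates a^(q^i) are roots of one nonzero polynomial, so they repeat; Frobenius being
    injective, they return to a. The least period gives distinct conjugates. *)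
Lemma frobenius_period (a : K) : algebraicOver io a ->
  exists m, [/\ (0 < m)%N, a ^+ (q ^ m) = a & uniq (frob_orbit a m)].
Proof.
case=> p p0 pa.
have nth_orbit m i : (i < m)%N -> nth 0 (frob_orbit a m) i = a ^+ (q ^ i).
  by move=> lt_im; rewrite (nth_map 0%N) ?size_iota // nth_iota.
have repeats m : ~~ uniq (frob_orbit a m) ->
    exists d, [/\ (0 < d)%N, (d < m)%N & a ^+ (q ^ d) = a].
  case/(uniqPn 0) => i [k [lt_ik]]; rewrite size_map size_iota => lt_km.
  rewrite !nth_orbit ?(ltn_trans lt_ik) // => e.
  exists (k - i)%N; rewrite subn_gt0 lt_ik (leq_ltn_trans (leq_subr _ _)) //.
  by split=> //; apply: (@frobenius_inj i); rewrite -frob_iterD subnK // ltnW.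
have ex_m : exists m, (0 < m)%N && (a ^+ (q ^ m) == a).
  have [d [d_gt0 _ da]] : exists d, [/\ (0 < d)%N,
    (d < size p)%N & a ^+ (q ^ d) = a].
    apply: repeats; apply/negP => u.
    have := @max_poly_roots _ (map_poly io p) _ _ _ u.
    rewrite map_poly_eq0 p0 size_map_poly size_map size_iota ltnn.
    move=> /(_ isT) H; suff : false by []. 
    apply: H; apply/allP => _ /mapP[i _ ->]; exact: root_frob_orbit.
  by exists d; rewrite d_gt0 da /=.
have [m /andP[m_gt0 /eqP am] m_min] := ex_minnP ex_m.
exists m; split=> //; apply/negPn/negP => /repeats[d [d_gt0 lt_dm da]].
by have := m_min d; rewrite d_gt0 da eqxx leqNgt lt_dm => /(_ isT).
Qed.

(** Frobenius permutes the factors, so it fixes the coefficients of the product. *)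
Lemma frob_orbit_poly (a : K) m : (0 < m)%N -> a ^+ (q ^ m) = a ->
  exists g, map_poly io g = \prod_(c <- frob_orbit a m) ('X - c%:P).
Proof.
move=> m_gt0 am; set P := \prod_(c <- _) _.
have [phi phiE] := finField_frobenius io.
have phiP : map_poly phi P = P.
  rewrite /P !big_map rmorph_prod /=.
  have phi_factor i : map_poly phi ('X - (a ^+ (q ^ i))%:P) =
    'X - (a ^+ (q ^ i.+1))%:P.
    by rewrite rmorphB /= map_polyX map_polyC /= phiE -exprM -expnSr.
  under eq_bigr do rewrite phi_factor.
  rewrite -[m]subn0 -!/(index_iota 0 m).
  case: (m) m_gt0 am => // n _ am.
  by rewrite big_nat_recr //= am [RHS]big_nat_recl //= expr1 mulrC.
have coefP i : exists d, io d = P`_i.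
  by apply: fixed_by_frobenius; rewrite -phiE -coef_map phiP.
exists (\poly_(i < size P) sval (cid (coefP i))).
apply/polyP => i; rewrite coef_map coef_poly; case: ltnP => [_|le_Pi].
  exact: svalP (cid (coefP i)).
by rewrite nth_default //; apply: rmorph0.
Qed.

(** The orbit polynomial descends to F and shares the root a with the irreducible f, so f divides
    it: the roots of f are simple and lie in the orbit. *)
Lemma irreducible_frob_orbit f (a : K) : irreducible_poly f ->
  root (map_poly io f) a -> exists m, [/\ (0 < m)%N, a ^+ (q ^ m) = a,
    uniq (frob_orbit a m), separable_poly (map_poly io f)
    & forall b, (b \in frob_orbit a m) = root (map_poly io f) b].
Proof.
move=> f_irr fa.
have f0 : f != 0 by rewrite -size_poly_gt0 ltnW //; case: f_irr.
have [m [m_gt0 am u]] : exists m, [/\ (0 < m)%N, a ^+ (q ^ m) =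
  a & uniq (frob_orbit a m)].
  by apply: frobenius_period; exists f.
have [g gE] := frob_orbit_poly m_gt0 am.
have a_in : a \in frob_orbit a m.
  by apply/mapP; exists 0%N; rewrite ?mem_iota ?expr1.
have f_g : f %| g.
  have : ~~ coprimep (map_poly io f) (map_poly io g).
    apply/negP => co; have := coprimep_root co fa.
    by rewrite -[_ == 0]/(root _ a) gE root_prod_XsubC a_in.
  rewrite coprimep_map /coprimep => co.
  have := f_irr.2 _ co (dvdp_gcdl f g); rewrite /eqp => /andP[_ f_gcd].
  exact: dvdp_trans f_gcd (dvdp_gcdr f g).
have fK_g : map_poly io f %| \prod_(c <- frob_orbit a m) ('X - c%:P).
  by rewrite -gE dvdp_map.
exists m; split=> //.
  by apply: dvdp_separable fK_g _; rewrite separable_prod_XsubC.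
move=> b; apply/idP/idP => [/mapP[i _ ->]|fb]; first exact: root_frob_orbit.
by rewrite -root_prod_XsubC -dvdp_XsubCl; apply: dvdp_trans fK_g;
  rewrite dvdp_XsubCl.
Qed.

(** [tau] fixes the coefficients of the orbit polynomial of a, so it sends a to one of its roots. *)
Lemma galois_conjugate (L : fieldType) (j : {rmorphism K -> L})
    (tau : {rmorphism L -> L}) (a : K) : algebraicOver io a ->
  (forall c, tau (j (io c)) = j (io c)) ->
  exists i, tau (j a) = j (a ^+ (q ^ i)).
Proof.
move=> a_alg tauF; have [m [m_gt0 am _]] := frobenius_period a_alg.
have [g gE] := frob_orbit_poly m_gt0 am.
have : root (map_poly j (map_poly io g)) (tau (j a)).
  have <- : map_poly tau (map_poly j (map_poly io g)) =
    map_poly j (map_poly io g).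
    by apply/polyP => k; rewrite !coef_map /= tauF.
  rewrite !fmorph_root gE root_prod_XsubC; apply/mapP.
  by exists 0%N; rewrite ?mem_iota ?expr1.
rewrite gE rmorph_prod /= => /rootP; rewrite horner_prod => /eqP.
rewrite prodf_seq_eq0 => /hasP[_ /mapP[i _ ->]] /=.
by rewrite rmorphB /= map_polyX map_polyC hornerXsubC subr_eq0 => /eqP ->;
  exists i.
Qed.

End Orbit.

(* A finite set of elements lies in a finite field, whose multiplicative      *)
(* group is cyclic; tau is determined on it by its value at a generator.      *)
Lemma galois_finite_frobenius (F : finFieldType) (K : closedFieldType)
    (io : {rmorphism F -> K}) (L : fieldType) (j : {rmorphism K -> L})
    (tau : {rmorphism L -> L}) (S : seq K) :
  (forall a, algebraicOver io a) -> (forall c, tau (j (io c)) = j (io c)) ->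
  exists n, {in S, forall s, tau (j (s ^+ (#|F| ^ n))) = j s}.
Proof.
move=> K_alg tauF; set q := #|F|.
have q_gt1 : (1 < q)%N := card_finNzRing_gt1 F.
have [N N_gt0 SN] : exists2 N, (0 < N)%N & {in S, forall s, s ^+ (q ^ N) = s}.
  elim: S => [|s S [N N_gt0 IH]]; first by exists 1%N.
  have [m [m_gt0 sm _]] := frobenius_period (K_alg s).
  exists (N * m)%N => [|s']; first by rewrite muln_gt0 N_gt0.
  rewrite inE => /orP[/eqP->|/IH]; first by rewrite mulnC;
    apply: frob_period_mul.
  exact: frob_period_mul.
pose M := (q ^ N).-1.
have qN_gt1 : (1 < q ^ N)%N by rewrite -(exp1n N) ltn_exp2r.
have M_gt0 : (0 < M)%N by rewrite /M -ltnS prednK // ltnW.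
have MS : M.+1 = (q ^ N)%N by rewrite prednK // ltnW.
have q0 : q%:R = 0 :> K.
  have [p pF /p_natP[k q_eq]] := finField_pnat F.
  rewrite -(rmorph_nat io) /q q_eq natrX (pcharf0 pF) rmorphXn rmorph0 expr0n.
  by move: q_gt1; rewrite /q q_eq; case: k {q_eq}.
have M0 : M%:R != 0 :> K.
  have : M.+1%:R = 0 :> K by rewrite MS natrX q0 expr0n eqn0Ngt N_gt0.
  by rewrite -natr1 => /eqP; rewrite addr_eq0 => /eqP ->;
    rewrite oppr_eq0 oner_eq0.
have [rs rsE] := closed_field_poly_normal ('X^M - 1 : {poly K}).
rewrite lead_coefXnsubC // scale1r in rsE.
have rs_uniq : uniq rs by rewrite -separable_prod_XsubC -rsE separable_Xn_sub_1.
have rs_size : size rs = M.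
  by have := congr1 (fun p : {poly K} => size p) rsE;
    rewrite size_XnsubC // size_prod_XsubC => -[].
have rs_root : all M.-unity_root rs.
  by apply/allP => c cr; rewrite /root_of_unity rsE root_prod_XsubC.
have /hasP[theta _ prim] := has_prim_root M_gt0 rs_root rs_uniq (eq_leq (esym
  rs_size)).
have [m thetaE] := galois_conjugate (K_alg theta) tauF.
have tau_s s : s \in S -> tau (j s) = j (s ^+ (q ^ m)).
  move=> /SN sN; have [->|s0] := eqVneq s 0.
    by rewrite expr0n expn_eq0 eqn0Ngt (ltnW q_gt1) !rmorph0.
  have sM : s ^+ M = 1 by apply: (mulfI s0); rewrite -exprS MS sN mulr1.
  have [k ->] := prim_rootP prim sM.
  by rewrite !rmorphXn thetaE -!rmorphXn -!exprM mulnC.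
(* [tau] is the q^m-th power on [S], and (N - 1) m inverts m there, since m + (N - 1) m is a
   multiple of the period N. *)
exists (N.-1 * m)%N => s sS.
rewrite rmorphXn rmorphXn tau_s // -rmorphXn -frob_iterD.
have -> : (m + N.-1 * m = N * m)%N by rewrite -mulSn prednK.
by rewrite frob_period_mul ?SN.
Qed.

(** * Frobenius and rationality *)

(** In [.[x, y]] the outer indeterminate receives x, whereas in [ev2] it receives y. *)
Lemma ev2_swap (K L : fieldType) (j : {rmorphism K -> L}) (x y : L)
    (P : {poly {poly K}}) :
  (map_poly (map_poly j) P).[x, y] = ev2 j x y (swapXY P).
Proof.
rewrite -(horner2_swapXY _ y x) swapXY_map; set Q := swapXY P.
rewrite (ev2_wide _ _ _ (leqnn (size Q))).
rewrite [(map_poly _ Q).[_]](@horner_coef_wide _ (size Q)) ?size_poly //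
  horner_sum.
by apply: eq_bigr => i _; rewrite coef_map -rmorphXn hornerM hornerC.
Qed.

(** As l is prime, a nontrivial l-th root of unity is primitive, which also makes l nonzero in K; y
    is nonzero because x is transcendental. *)
Lemma function_field_kummer (K L : fieldType) (j : {rmorphism K -> L}) l
    (h : {poly K}) (x y : L) (zeta : K) (zetaL : L -> L) :
  prime l -> h != 0 -> function_field j l h x y -> zeta ^+ l = 1 -> zeta != 1 ->
  comorphism j x y zetaL x (j zeta * y) -> kummer j l h x y zeta zetaL.
Proof.
move=> l_pr h0 [x_tr y_l gen] zeta_l zeta1 [zK zx zy].
have l_gt0 := prime_gt0 l_pr.
have prim : l.-primitive_root zeta.
  have [m m_prim] := prim_order_exists l_gt0 zeta_l.
  move/primeP: l_pr => [_ m_l] /m_l /pred2P[m1|<-//].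
  by move: (prim_expr_order m_prim) zeta1; rewrite m1 expr1 => ->; rewrite eqxx.
split=> //.
- apply: contra_neq h0 => y0; apply: contra_notP x_tr => /eqP h0.
  exists h => //; rewrite /root -y_l y0 expr0n eqn0Ngt l_gt0 //=.
- move=> g; have [P [Q [Q0 ->]]] := gen g.
  by exists (swapXY P), (swapXY Q); rewrite -!ev2_swap.
exact: prim_root_natf_neq0 prim.
Qed.

Section Frobenius.

Variables (F : finFieldType) (K : closedFieldType) (io : {rmorphism F -> K}).
Variables (L : fieldType) (j : {rmorphism K -> L}) (l : nat).
Variables (h : {poly K}) (x y : L) (zeta : K) (zetaL frobL :
  {rmorphism L -> L}).
Hypothesis model : kummer j l h x y zeta zetaL.
Local Notation q := #|F|.
Hypothesis frobLP : comorphism j x y frobL (x ^+ q) (y ^+ q).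

Let q_gt0 : (0 < q)%N := ltnW (card_finNzRing_gt1 F).

Lemma expq_inj : injective (fun g : L => g ^+ q).
Proof. by have := frobenius_inj (j \o io) (n := 1); rewrite expn1. Qed.

Lemma expqD (g1 g2 : L) : (g1 + g2) ^+ q = g1 ^+ q + g2 ^+ q.
Proof. exact: (finField_frobeniusD (j \o io)). Qed.

(* The relative Frobenius frobL is the q-th power map followed by the inverse *)
(* s of an automorphism, the arithmetic Frobenius.                            *)
Lemma arithmetic_frobenius :
  exists s : {rmorphism L -> L}, forall g, s g ^+ q = frobL g.
Proof.
have [frobC frobX frobY] := frobLP.
have /all_sig[s sE] g : {h | h ^+ q = frobL g}.
  apply: cid; move: g; apply: (fun_field_ind model).
  - move=> c; have [b bc] := closed_nth_root c q_gt0.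
    by exists (j b); rewrite -rmorphXn bc frobC.
  - by exists x.
  - by exists y.
  - by move=> g1 g2 [h1 E1] [h2 E2]; exists (h1 + h2);
    rewrite expqD E1 E2 rmorphD.
  - by move=> g1 g2 [h1 E1] [h2 E2]; exists (h1 * h2);
    rewrite exprMn E1 E2 rmorphM.
  - by move=> g1 [h1 E1]; exists h1^-1; rewrite exprVn E1 fmorphV.
have sB : zmod_morphism s.
  move=> g1 g2; apply: (addIr (s g2)); rewrite subrK; apply: expq_inj => /=.
  by rewrite expqD !sE -rmorphD subrK.
have sM : monoid_morphism s.
  split=> [|g1 g2]; apply: expq_inj; rewrite /= ?exprMn !sE ?expr1n ?rmorph1 //.
  by rewrite rmorphM.
pose s' : {rmorphism L -> L} := HB.pack s
  (GRing.isZmodMorphism.Build L L s sB) (GRing.isMonoidMorphism.Build L L s sM).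
by exists s'.
Qed.

Variable s : {rmorphism L -> L}.
Hypothesis sE : forall g, s g ^+ q = frobL g.

Lemma sX : s x = x.
Proof. by apply: expq_inj; rewrite /= sE; case: frobLP. Qed.
Lemma sY : s y = y.
Proof. by apply: expq_inj; rewrite /= sE; case: frobLP. Qed.
Lemma sC a : s (j (a ^+ q)) = j a.
Proof. by apply: expq_inj; rewrite /= sE -rmorphXn; case: frobLP. Qed.

Lemma s_surj g : exists h, s h = g.
Proof.
move: g; apply: (fun_field_ind model).
- by move=> c; exists (j (c ^+ q)); rewrite sC.
- by exists x; rewrite sX.
- by exists y; rewrite sY.
- by move=> g1 g2 [h1 <-] [h2 <-]; exists (h1 + h2); rewrite rmorphD.
- by move=> g1 g2 [h1 <-] [h2 <-]; exists (h1 * h2); rewrite rmorphM.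
- by move=> g1 [h1 <-]; exists h1^-1; rewrite fmorphV.
Qed.

Lemma s_auto : const_auto j s.
Proof.
split; [exact: s_surj | split=> a].
  have [b <-] := closed_nth_root a q_gt0; exists b; exact: sC.
by exists (a ^+ q); apply: sC.
Qed.

Lemma s_fixF c : s (j (io c)) = j (io c).
Proof. by rewrite -{1}(expf_card c) rmorphXn sC. Qed.

(** Taking q-th powers keeps the sign of an order, so [frobL] and [s] induce the same map on
    places. *)
Lemma push_frobL : push frobL =1 push s :> (jacobian j -> jacobian j).
Proof.
apply: eq_push => P; apply: eq_place_image => g.
by rewrite -sE ordX pmulrn_lge0.
Qed.

(** Both sides fix x and agree on constants and on y, since [s] sends zeta^q to zeta; the check is
    made after raising to the power q. *)
Lemma s_zeta g : zetaL (s g) = s (iter q zetaL g).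
Proof.
apply: expq_inj; rewrite /= sE -rmorphXn sE.
have [frobC frobX frobY] := frobLP.
move: g; apply: (fun_field_ind model) => [c||||g1 g2 E1 E2|g1 E1].
- by rewrite (iter_zetaC model) frobC (kummer_fixC model).
- have -> : iter q zetaL x = x by elim: q => //= n ->; apply: kummer_fixX model.
  by rewrite frobX rmorphXn /= (kummer_fixX model).
- rewrite (iter_zetaY model) rmorphM /= frobC frobY rmorphXn /=.
  by rewrite (kummer_act model) exprMn rmorphXn.
- by move=> g1 g2 E1 E2; rewrite iter_rmorphD !rmorphD /= E1 E2.
- by rewrite iter_rmorphM !rmorphM /= E1 E2.
by rewrite iter_rmorphV !fmorphV /= E1.
Qed.

Local Notation J := (jacobian j).
Local Notation divisor := {freeg (place j) / int}.

Lemma push_pi_s (D : div0 j) : push s (\pi_J D) = \pi_J (push_div0 s D).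
Proof. exact: push_pi s_auto D. Qed.

Lemma push_s_zeta (v : J) :
  push s (push zetaL v) = iter q (push zetaL) (push s v).
Proof.
have place_eq (P : place j) : place_image s (place_image zetaL P) =
    iter q (place_image zetaL) (place_image s P).
  apply: place_ext => g; rewrite (ord_iter_rho model) !ord_place_image ?s_zeta
    //.
  - exact: s_auto.
  - exact: zetaL_auto model.
  exact: s_auto.
have div_eq (D : divisor) : push_div s (push_div zetaL D) =
    iter q (push_div zetaL) (push_div s D).
  have iter_sum n (r : seq (place j)) (G : place j -> divisor) :
      iter n (push_div zetaL) (\sum_(P <- r) G P) =
        \sum_(P <- r) iter n (push_div zetaL) (G P).
    by elim: n => //= n ->; rewrite raddf_sum.
  rewrite -[D in LHS]freeg_sumE -[D in RHS]freeg_sumE.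
  rewrite (raddf_sum (push_div zetaL)) !(raddf_sum (push_div s)) iter_sum.
  apply: eq_bigr => P _ /=; rewrite !push_divU iter_push_divU place_eq //.
elim/quotW: v => D; rewrite (push_pi_zeta model) !push_pi_s.
have iter_pi n (E : div0 j) :
  iter n (push zetaL) (\pi_J E) = \pi_J (iter n (push_div0 zetaL) E).
  by elim: n => //= n ->; rewrite (push_pi_zeta model).
rewrite iter_pi; congr (\pi_J _); apply: val_inj.
rewrite !val_push_div0 div_eq.
have val_iter n (E : div0 j) :
  val (iter n (push_div0 zetaL) E) = iter n (push_div zetaL) (val E).
  by elim: n => //= n <-; rewrite val_push_div0.
by rewrite val_iter val_push_div0.
Qed.

End Frobenius.

Section Rationality.

Variables (F : finFieldType) (K : closedFieldType) (io : {rmorphism F -> K}).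
Hypothesis K_alg : forall a, algebraicOver io a.
Variables (L : fieldType) (j : {rmorphism K -> L}) (l : nat).
Variables (h : {poly K}) (x y : L) (zeta : K) (zetaL frobL :
  {rmorphism L -> L}).
Hypothesis model : kummer j l h x y zeta zetaL.
Hypothesis co_dl : coprime (size h).-1 l.
Hypothesis h_sep : forall a, root h a -> (h^`()).[a] != 0.
Local Notation q := #|F|.
Hypothesis frobLP : comorphism j x y frobL (x ^+ q) (y ^+ q).
Variable s : {rmorphism L -> L}.
Hypothesis sE : forall g, s g ^+ q = frobL g.

Local Notation J := (jacobian j).
Local Notation divisor := {freeg (place j) / int}.
Local Notation infty := (infty model co_dl).
Local Notation pl := (pl model co_dl).
Local Notation centered := (centered x y).
Local Notation s_auto := (s_auto io model frobLP sE).

Section Automorphism.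

Variable theta : {rmorphism L -> L}.
Hypotheses (theta_auto : const_auto j theta) (theta_x : theta x = x).

Lemma place_image_infty : place_image theta infty = infty.
Proof.
apply: infty_uniq; rewrite ord_place_image // theta_x ord_infty_x.
by rewrite oppr_lt0 ltz_nat (prim_order_gt0 (kummer_root model)).
Qed.

Lemma place_image_centered (P : place j) a b a' b' :
  theta y = y -> theta (j a') = j a -> theta (j b') = j b ->
  centered P a b -> centered (place_image theta P) a' b'.
Proof.
have van g : vanish (place_image theta P) g = vanish P (theta g).
  by rewrite /vanish ord_place_image // fmorph_eq0.
move=> theta_y aa' bb' Pab; rewrite /centered !van !rmorphB /=.
by rewrite theta_x theta_y aa' bb'.
Qed.

End Automorphism.

(** [s] sends the constant a^q to a, so on points it raises coordinates to the power q. *)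
Lemma s_centered n (P : place j) a b : centered P a b ->
  centered (iter n (place_image s) P) (a ^+ (q ^ n)) (b ^+ (q ^ n)).
Proof.
move=> Pab; elim: n => [|n IH]; first by rewrite !expr1.
rewrite iterS !expnSr !exprM; apply: (place_image_centered s_auto _ _ _ _ IH).
- exact: (sX io frobLP sE).
- exact: (sY io frobLP sE).
- exact: (sC io frobLP sE).
exact: (sC io frobLP sE).
Qed.

(** [s] is itself one of the automorphisms over F(x, y). Conversely, any such automorphism acts on
    the support of a given divisor as an iterate of [s]. *)
Lemma push_fixed_rational (v : J) :
  push frobL v = v <-> rational io x y v.
Proof.
rewrite (push_frobL sE); split=> [|rat_v]; last first.
  apply: rat_v.
  - apply: (@Bijective _ _ s (fun g =>
    sval (cid (s_surj io model frobLP sE g)))) => g.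
      apply: (fmorph_inj s).
      exact: svalP (cid (s_surj io model frobLP sE (s g))).
    exact: svalP (cid (s_surj io model frobLP sE g)).
  - exact: (s_fixF io frobLP sE).
  - exact: (sX io frobLP sE).
  - exact: (sY io frobLP sE).
elim/quotW: v => D sv tau tau_bij tauF tau_x tau_y.
have tau_auto : const_auto j tau.
  split; [|split] => a.
  - by case: tau_bij => inv _ tauK; exists (inv a).
  - by have [i ->] := galois_conjugate (K_alg a) tauF; exists (a ^+ (q ^ i)).
  have [n nP] := @galois_finite_frobenius _ _ io _ j tau [:: a] K_alg tauF.
  by exists (a ^+ (q ^ n)); apply: nP; rewrite inE.
have /all_sig[co coP] (P : place j) : {ab :
  K * K | P = infty \/ centered P ab.1 ab.2}.
  apply: cid; case: (place_cases model co_dl P) => [->|[a [b Pab]]].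
    by exists (0, 0); left.
  by exists (a, b); right.
(* All coordinates of the finite points in the support of D, so that one exponent n serves for every
   point. *)
pose S := [seq (co P).1 | P <- dom (val D)] ++ [seq (co P).2 | P <- dom (val
  D)].
have [n nP] := @galois_finite_frobenius _ _ io _ j tau S K_alg tauF.
have place_eq P : P \in dom (val D) -> place_image tau P =
  iter n (place_image s) P.
  move=> PD; case: (coP P) => [->|Pab].
    rewrite place_image_infty //; elim: n {nP} => //= n <-.
    by rewrite place_image_infty //; [apply: s_auto | apply: (sX io frobLP sE)].
  rewrite (pl_uniq model co_dl h_sep (s_centered n Pab)).
  apply: (pl_uniq model co_dl h_sep);
    apply: (place_image_centered tau_auto) Pab => //.
    by apply: nP; rewrite mem_cat (map_f (fun P => (co P).1)).
  by apply: nP; rewrite mem_cat; apply/orP; right;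
    apply: (map_f (fun P => (co P).2)).
have iter_push_s m k P : iter m (push_div s) << k *g P >> =
  << k *g iter m (place_image s) P >> :> divisor.
  by elim: m => //= m ->; rewrite push_divU.
have div_eq : push_div0 tau D = iter n (push_div0 s) D.
  apply: val_inj; rewrite val_push_div0.
  have -> : val (iter n (push_div0 s) D) = iter n (push_div s) (val D).
    by elim: n {nP place_eq} => //= n <-; rewrite val_push_div0.
  have iter_sum m (r : seq (place j)) (G : place j -> divisor) :
      iter m (push_div s) (\sum_(P <- r) G P) =
        \sum_(P <- r) iter m (push_div s) (G P).
    by elim: m => //= m ->; rewrite raddf_sum.
  rewrite -[val D in RHS]freeg_sumE iter_sum; apply: eq_big_seq => P PD.
  by rewrite place_eq // iter_push_s.
rewrite (push_pi tau_auto) div_eq.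
elim: n {nP place_eq div_eq} => //= n IH.
by rewrite -(push_pi_s io model frobLP sE) IH.
Qed.

Lemma push_branch_div a : root h a ->
  push frobL (\pi_J (branch_div model co_dl a)) =
    \pi_J (branch_div model co_dl (a ^+ q)).
Proof.
move=> ha; rewrite (push_frobL sE) (push_pi_s io model frobLP sE).
congr (\pi_J _); apply: val_inj; rewrite val_push_div0 !val_branch_div.
rewrite (raddfB (push_div s)) /= !push_divU.
rewrite place_image_infty //; [|exact: s_auto|exact: (sX io frobLP sE)].
have l_gt0 := prim_order_gt0 (kummer_root model).
have q_gt0 : (0 < q)%N := ltnW (card_finNzRing_gt1 F).
have a0 : centered (pl a 0) a 0.
  by apply: (pl_centered model co_dl h_sep);
    rewrite expr0n eqn0Ngt l_gt0 (rootP ha).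
have := s_centered 1 a0; rewrite /= expn1 expr0n eqn0Ngt q_gt0 /=.
by move/(pl_uniq model co_dl h_sep) => ->.
Qed.

Lemma push_zeta_branch_div a : root h a ->
  push zetaL (\pi_J (branch_div model co_dl a)) =
    \pi_J (branch_div model co_dl a).
Proof.
move=> ha; rewrite (push_pi_zeta model).
congr (\pi_J _); apply: val_inj; rewrite val_push_div0 !val_branch_div.
rewrite (raddfB (push_div zetaL)) /= !push_divU (rho_infty model co_dl).
have l_gt0 := prim_order_gt0 (kummer_root model).
have a0 : centered (pl a 0) a 0.
  by apply: (pl_centered model co_dl h_sep);
    rewrite expr0n eqn0Ngt l_gt0 (rootP ha).
have := rho_centered model a0; rewrite mulr0.
by move/(pl_uniq model co_dl h_sep) => ->.
Qed.

End Rationality.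

(** * Application to the Jacobian of the curve *)

Theorem theorem1p9
  (l : nat) (l_prime : prime l) (l_ge3 : (3 <= l)%N)
  (F : finFieldType) (co_q_l : coprime #|F| l)
  (f : {poly F}) (f_irr : irreducible_poly f) (co_d_l : coprime (size f).-1 l)
  (K : closedFieldType) (iota : {rmorphism F -> K})
  (K_alg : forall a : K, algebraicOver iota a)
  (L : fieldType) (j : {rmorphism K -> L}) (x y : L)
  (L_ff : function_field j l (map_poly iota f) x y)
  (zeta : K) (zeta_root : zeta ^+ l = 1) (zeta_neq1 : zeta != 1)
  (zetaL : {rmorphism L -> L}) (zetaLP : comorphism j x y zetaL x (j zeta * y))
  (frobL : {rmorphism L -> L})
  (frobLP : comorphism j x y frobL (x ^+ #|F|) (y ^+ #|F|)) :
  let J := jacobian j in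
  let zetaJ : J -> J := push zetaL in
  let Frob : J -> J := push frobL in
  is_dim_Fl l (fun v : J => torsion l v /\ rational iota x y v)
    #|[set k : 'I_l | (1 <= k <= l - 1)%N &&
         `[< exists v : J, F_ l #|F| Frob zetaJ (k%:Z - 1) k v
                           /\ eigenvector l Frob v >]]|.
Proof.
move=> J zetaJ Frob.
have size_f : (1 < size f)%N by case: f_irr.
set h := map_poly iota f.
have h0 : h != 0 by rewrite map_poly_eq0 -size_poly_gt0 ltnW.
have model := function_field_kummer l_prime h0 L_ff zeta_root zeta_neq1 zetaLP.
have co_dl : coprime (size h).-1 l by rewrite size_map_poly.
have h_sep a : root h a -> (h^`()).[a] != 0.
  move=> ha; have [_ [_ _ _ sep _]] := irreducible_frob_orbit f_irr ha.
  by move: sep; rewrite separable_poly.unlock => /coprimep_root; apply.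
have [s sE] := arithmetic_frobenius iota model frobLP.
have [a0 ha0] : exists a, root h a.
  by apply/closed_rootP; rewrite size_map_poly gtn_eqF.
have [d [d_gt0 a0d orbit_uniq _ orbitP]] := irreducible_frob_orbit f_irr ha0.
(* The results on direct images concern automorphisms, hence the passage from [frobL] to [s]. *)
have FrobE : Frob =1 push s := push_frobL sE.
have FrobB : zmod_morphism Frob.
  by move=> u v; rewrite !FrobE;
    apply: push_is_zmod_morphism (s_auto iota model frobLP sE) _ _.
have zetaB : zmod_morphism zetaJ.
  exact: push_is_zmod_morphism (zetaL_auto model).
pose Fr : {additive J -> J} := HB.pack Frob (GRing.isZmodMorphism.Build J J
  Frob FrobB).
pose Ze : {additive J -> J} := HB.pack zetaJ (GRing.isZmodMorphism.Build J J
  zetaJ zetaB).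
pose w := \pi_J (branch_div model co_dl a0).
have iter_w i : iter i Frob w =
  \pi_J (branch_div model co_dl (a0 ^+ (#|F| ^ i))).
  elim: i => [|i IH]; first by rewrite expr1.
  rewrite iterS IH /Frob (push_branch_div iota model co_dl h_sep frobLP sE)
    ?expnSr ?exprM //.
  exact: root_frob_orbit.
have FZ v : Fr (Ze v) = iter #|F| Ze (Fr v).
  by rewrite /= !FrobE; apply: (push_s_zeta iota model frobLP sE).
have sumZ v : \sum_(i < l) iter i Ze v =
  0 by apply: (sum_push model co_dl h_sep).
have Zw : Ze w = w by apply: (push_zeta_branch_div model co_dl h_sep ha0).
have Fdw : iter d Fr w = w by rewrite /= iter_w a0d.
have kerZ v : Ze v = v -> exists n :
  nat -> int, v = \sum_(i < d) iter i Fr w *~ n i.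
  move=> Zv; have [n ->] := ker_push model co_dl h_sep orbit_uniq orbitP Zv.
  (* The roots of h are the Frobenius conjugates of [a0], so the coefficients are reindexed by the
     exponent. *)
  exists (fun i => n (a0 ^+ (#|F| ^ i))).
  rewrite /frob_orbit big_map -[d in seq.iota 0 d]subn0 -/(index_iota 0 d)
    big_mkord.
  by apply: eq_bigr => i _; rewrite iter_w.
have [e [eS e_basis]] := Frobenius_fixed_dim l_prime FZ sumZ d_gt0 Zw Fdw kerZ.
have fixedE v : Frob v = v <-> rational iota x y v.
  exact: (push_fixed_rational K_alg model co_dl h_sep frobLP sE).
exists e; split=> [i|v [tv /fixedE Fv]]; last exact: e_basis.
by have [te Fe] := eS i; split=> //; apply/fixedE.
Qed.
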